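(* There exists a $C^\infty$ partially hyperbolic diffeomorphism $f:\mathbb{T}^3\to\mathbb{T}^3$ with a partially hyperbolic splitting $$T\mathbb{T}^3 = E^{uu}_f \oplus_{\succ} E^{c}_f \oplus_{\succ} F^{ss}_f$$ such that $f$ is partially volume-expanding and $f$ has a hyperbolic fixed point with unstable index $2$ (i.e. the unstable subspace of $Df$ at this fixed point has dimension $2$). Moreover, there exists a $C^1$-neighborhood $\mathcal{U}_f$ of $f$ such that every diffeomorphism $g\in\mathcal{U}_f$ is also partially volume-expanding.
   Context: A diffeomorphism $f:M\to M$ of a smooth compact Riemannian manifold is partially hyperbolic if there are a continuous $Df$-invariant splitting $TM=E^{uu}\oplus_{\succ}E^{cs}$ and constants $c>0$, $\sigma>1$ such that for all $n\ge 1$: (i) $\|Df^n v^u\|\ge c\,\sigma^n\|v^u\|$ for all $v^u\in E^{uu}$; (ii) $\|Df^n v^u\|/\|Df^n v^{cs}\|\ge c\,\sigma^n$ for all unit vectors $v^u\in E^{uu}$, $v^{cs}\in E^{cs}$ at the same point. The notation $E_1\oplus_{\succ}E_2$ means that $E_2$ is dominated by $E_1$, in the sense of (ii). A partially hyperbolic splitting $T\mathbb{T}^3=E^{uu}_f\oplus_{\succ}E^c_f\oplus_{\succ}F^{ss}_f$ is a continuous $Df$-invariant splitting into one-dimensional bundles, in which each bundle dominates the next, $E^{uu}_f$ is uniformly expanded and $F^{ss}_f$ is uniformly contracted by $Df$; here $E^{cs}=E^c_f\oplus F^{ss}_f$ plays the role of the center-stable bundle (so $\dim E^{cs}=2$).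 A partially hyperbolic diffeomorphism $f$ is partially volume-expanding if $|\det Df(x)|_H|>1$ for every $x\in M$ and every codimension-one linear subspace $H$ of $T_xM$ that contains $E^{uu}_x$ (here $\det Df(x)|_H$ is the Jacobian of $Df(x):H\to Df(x)H$). The torus $\mathbb{T}^3=\mathbb{R}^3/\mathbb{Z}^3$ carries the Riemannian metric induced by the Euclidean metric of $\mathbb{R}^3$. *)

(* Defs.v *)
From HB Require Import structures.
From mathcomp Require Import all_boot all_order all_algebra.
From mathcomp Require Import all_classical all_reals all_analysis.
From mathcomp Require Import complex.

Set Implicit Arguments.
Unset Strict Implicit.
Unset Printing Implicit Defensive.

Import Order.TTheory GRing.Theory Num.Theory.
Import numFieldNormedType.Exports.

Local Open Scope classical_set_scope.
Local Open Scope quotient_scope.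
Local Open Scope ring_scope.

(* Vectors are row vectors and matrices act on the right: the image of [v]
   under a linear map with matrix [A] is [v *m A].  A linear subspace is the row
   space of a matrix.  [R] is any model of the real numbers. *)

Section Torus.
Variable R : realType.
Local Notation V := 'rV[R]_3.

Definition lattice_eq (x y : V) : bool :=
  `[< exists k : 'rV[int]_3, x - y = map_mx intr k >].

Lemma lattice_eq_refl : reflexive lattice_eq.
Proof. by move=> x; apply/asboolP; exists 0; rewrite subrr map_mx0. Qed.

Lemma lattice_eq_sym : symmetric lattice_eq.
Proof.
move=> x y; apply: asbool_equiv_eq.
by split=> -[k hk]; exists (- k); rewrite map_mxN -hk opprB.
Qed.

Lemma lattice_eq_trans : transitive lattice_eq.
Proof.
move=> y x z /asboolP[k hk] /asboolP[l hl]; apply/asboolP.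
by exists (k + l); rewrite map_mxD -hk -hl addrA subrK.
Qed.

Canonical lattice_eq_equiv :=
  EquivRel lattice_eq lattice_eq_refl lattice_eq_sym lattice_eq_trans.

Definition torus := {eq_quot lattice_eq}.

Definition tproj : V -> torus := \pi_{eq_quot lattice_eq}.
Definition trepr (p : torus) : V := repr (p : {eq_quot lattice_eq}).

(* The Euclidean norm; the library norm on matrices is the sup norm. *)
Definition enorm (v : V) : R := Num.sqrt (\sum_i v 0 i ^+ 2).

Definition tdist (p q : torus) : R :=
  inf [set d | exists x y, [/\ tproj x = p, tproj y = q & d = enorm (x - y)]].

(* Intended for [U] open. *)
Fixpoint Ck_on (k : nat) (U : set V) (F : V -> V) : Prop :=
  if k is k'.+1 then
    (forall x, U x -> differentiable F x) /\
    (forall v, Ck_on k' U ('D_v F))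
  else forall x, U x -> {for x, continuous F}.

(* The charts of the torus are the local inverses of [tproj], so a map of the
   torus is C^k iff locally it is induced by C^k maps of [V]. *)
Definition torus_Ck (k : nat) (f : torus -> torus) : Prop :=
  forall x : V, exists (U : set V) (F : V -> V),
    [/\ open U, U x, forall y, U y -> tproj (F y) = f (tproj y)
      & Ck_on k U F].

Definition Ck_diffeo (k : nat) (f : torus -> torus) : Prop :=
  torus_Ck k f /\
  exists g : torus -> torus, [/\ cancel f g, cancel g f & torus_Ck k g].

Definition smooth_diffeo (f : torus -> torus) : Prop :=
  forall k, Ck_diffeo k f.

(* All tangent spaces of the torus are identified with [V] by [tproj].
   The matrix below does not depend on the choice of the local lift [F], nor on
   that of the representative of [p]; it is 0 if [f] is not differentiable
   at [p]. *)
Definition tangent (f : torus -> torus) (p : torus) : 'M[R]_3 :=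
  xget 0 [set A | exists F : V -> V,
    [/\ \forall y \near trepr p, tproj (F y) = f (tproj y),
        differentiable F (trepr p) & A = jacobian F (trepr p)]].

(* A field of linear subspaces of the tangent spaces, locally spanned by
   continuous frames. *)
Definition continuous_bundle (E : torus -> 'M[R]_3) : Prop :=
  forall x : V, exists (k : nat) (B : V -> 'M[R]_(k, 3)),
    \forall y \near x,
      [/\ {for y, continuous B}, row_free (B y)
        & (B y == E (tproj y))%MS].

Definition invariant_bundle (f : torus -> torus) (E : torus -> 'M[R]_3) :=
  forall p, (E p *m tangent f p == E (f p))%MS.

Definition expansion (f : torus -> torus) (E : torus -> 'M[R]_3) (c s : R) :=
  forall n p (v : V), (1 <= n)%N -> (v <= E p)%MS ->
    c * s ^+ n * enorm v <= enorm (v *m tangent (iter n f) p).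

Definition domination (f : torus -> torus) (E1 E2 : torus -> 'M[R]_3)
    (c s : R) :=
  forall n p (v1 v2 : V), (1 <= n)%N ->
    (v1 <= E1 p)%MS -> (v2 <= E2 p)%MS -> enorm v1 = 1 -> enorm v2 = 1 ->
    c * s ^+ n <=
      enorm (v1 *m tangent (iter n f) p) / enorm (v2 *m tangent (iter n f) p).

Definition dominates (f : torus -> torus) (E1 E2 : torus -> 'M[R]_3) : Prop :=
  exists c s : R, [/\ 0 < c, 1 < s & domination f E1 E2 c s].

Definition uniformly_expanded (f : torus -> torus) (E : torus -> 'M[R]_3) :=
  exists c s : R, [/\ 0 < c, 1 < s & expansion f E c s].

Definition uniformly_contracted (f : torus -> torus) (E : torus -> 'M[R]_3) :=
  exists c s : R, [/\ 0 < c, 0 < s < 1 &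
    forall n p (v : V), (1 <= n)%N -> (v <= E p)%MS ->
      enorm (v *m tangent (iter n f) p) <= c * s ^+ n * enorm v].

Definition sum_bundle (E1 E2 : torus -> 'M[R]_3) (p : torus) : 'M[R]_3 :=
  (E1 p + E2 p)%MS.

(* [f] is partially hyperbolic with splitting [Eu] + [Ecs]; as usual, both
   bundles are required to be nonzero. *)
Definition ph_splitting (f : torus -> torus) (Eu Ecs : torus -> 'M[R]_3) :=
  [/\ continuous_bundle Eu /\ continuous_bundle Ecs,
      invariant_bundle f Eu /\ invariant_bundle f Ecs,
      forall p, Eu p != 0 /\ Ecs p != 0,
      forall p, mxdirect (Eu p + Ecs p) /\ row_full (Eu p + Ecs p)%MS
    & exists c s : R,
        [/\ 0 < c, 1 < s, expansion f Eu c s & domination f Eu Ecs c s]].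

Definition ph_splitting3 (f : torus -> torus) (Eu Ec Fs : torus -> 'M[R]_3) :=
  [/\ [/\ continuous_bundle Eu, continuous_bundle Ec & continuous_bundle Fs],
      [/\ invariant_bundle f Eu, invariant_bundle f Ec
        & invariant_bundle f Fs],
      forall p, [/\ \rank (Eu p) = 1, \rank (Ec p) = 1 & \rank (Fs p) = 1]%N,
      forall p, mxdirect (Eu p + Ec p + Fs p) /\
                row_full (Eu p + Ec p + Fs p)%MS
    & [/\ dominates f Eu Ec, dominates f Ec Fs, uniformly_expanded f Eu
        & uniformly_contracted f Fs]].

(* The Jacobian of [A] restricted to the subspace [H]: the ratio of the
   volumes of the parallelepipeds spanned by the image of a basis of [H] and by
   this basis, volumes being square roots of Gram determinants. *)
Definition gram_volume (k : nat) (B : 'M[R]_(k, 3)) : R :=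
  Num.sqrt (\det (B *m B^T)).

Definition jac_on (A H : 'M[R]_3) : R :=
  gram_volume (row_base H *m A) / gram_volume (row_base H).

Definition volume_expanding_along (f : torus -> torus)
    (Eu : torus -> 'M[R]_3) : Prop :=
  forall p (H : 'M[R]_3), \rank H = 2%N -> (Eu p <= H)%MS ->
    1 < jac_on (tangent f p) H.

Definition partially_volume_expanding (f : torus -> torus) : Prop :=
  exists Eu Ecs : torus -> 'M[R]_3,
    ph_splitting f Eu Ecs /\ volume_expanding_along f Eu.

Definition hyperbolic_mx (A : 'M[R]_3) : Prop :=
  A \in unitmx /\
  forall z : R[i], eigenvalue (map_mx (real_complex R) A) z -> `|z| != 1.

Definition unstable_space (A : 'M[R]_3) : set V :=
  [set v | (fun n => v *m invmx A ^+ n) @ \oo --> (0 : V)].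

Definition hyperbolic_fixed_point (f : torus -> torus) (p : torus)
    (index : nat) : Prop :=
  [/\ f p = p, hyperbolic_mx (tangent f p)
    & exists W : 'M[R]_3, \rank W = index /\
        unstable_space (tangent f p) = [set v | (v <= W)%MS]].

(* Neighborhoods of [f] in the C^1 topology on C^1 diffeomorphisms. *)
Definition C1_nbhd (f : torus -> torus) (U : set (torus -> torus)) : Prop :=
  exists2 eps : R, 0 < eps &
    forall g, Ck_diffeo 1 g ->
      (forall p, tdist (f p) (g p) < eps /\
                 `|tangent f p - tangent g p| < eps) ->
      U g.

End Torus.

(* Main.v *)
Require Import Defs.
From mathcomp Require Import all_boot all_order all_algebra.
From mathcomp Require Import all_classical all_reals all_analysis.
From mathcomp Require Import complex.
From mathcomp Require Import ring lra zify.

(** The map is a derived-from-Anosov diffeomorphism.  The symmetric integer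
    matrix [[1,1,1],[1,1,0],[1,0,0]] has an orthonormal eigenbasis (u, c, s) with
    eigenvalues about 2.247, -0.802 and 0.555.  Pushing along the center
    direction with a wave of small amplitude,

      F x = x M - (1/5) / (2 pi kappa) sin (2 pi k.x) c,
      k = (1, 0, -1),  kappa = k.c,

    keeps the direction c invariant and replaces the center eigenvalue -0.802 by
    a multiplier that oscillates between -1.002 and -0.602.  At the fixed point 0
    it is below -1, so the unstable index there is 2; everywhere it stays between
    the two other eigenvalues in modulus, so the domination survives.  The
    covector k is close to the center direction, so the wave has small
    derivatives along u and s.  In the eigenbasis, with vectors as rows, the
    derivative of F at a point has the form

      [[2.247, p, 0], [0, m, 0], [0, r, 0.555]],  |p| <= 0.08,  |r| <= 0.048.

    Planes that contain the strong unstable line are expanded in area because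
    the least favourable one, spanned by u and s, has Jacobian about
    2.247 * 0.555 = 1.247 > 1, that is, the inverse modulus of the center
    eigenvalue of the matrix.

    Since T^3 is parallelizable, all the inequalities used are pointwise
    inequalities between entries of the derivative in one constant basis
    ([dominated_mx]), hence they hold for every C^1-close map.  They imply that
    the cone around u is mapped into itself by the derivative, and by its
    transpose; the invariant line and plane bundles are the fixed points of the
    induced contractions on sections ([invariant_section], [cone_section]).  The
    transpose acts on conormals, so its invariant sections are the center-stable
    planes.  This gives the splitting, with one-step growth estimates that are
    iterated, and the area growth ([jac_on_gt1]), for all the maps at once
    ([dominated_partially_volume_expanding]).  For F itself the center-stable
    plane is the constant plane spanned by c and s, and the stable line inside it
    is again a fixed point of a contraction of sections ([model_splitting]).

    F is a C^oo diffeomorphism because F and its inverse are affine maps plus a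
    scalar function of one linear coordinate.  For the inverse this scalar
    function involves the inverse of theta + (delta / 2 pi) sin (2 pi theta),
    whose smoothness is obtained from an algebra of functions closed under
    differentiation ([phase_algebra_closed], [Ck_wave]). *)

Set Implicit Arguments.
Unset Strict Implicit.
Unset Printing Implicit Defensive.

Import Order.TTheory GRing.Theory Num.Theory.
Import numFieldNormedType.Exports.

Local Open Scope classical_set_scope.
Local Open Scope quotient_scope.
Local Open Scope ring_scope.

Local Notation i0 := (@Ordinal 3 0 isT).
Local Notation i1 := (@Ordinal 3 1 isT).
Local Notation i2 := (@Ordinal 3 2 isT).
Local Notation j0 := (@Ordinal 2 0 isT).
Local Notation j1 := (@Ordinal 2 1 isT).

(** * Maps of the torus and their tangent maps *)

Lemma continuous_near_eq (U W : topologicalType) (f g : U -> W) x :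
  (\forall y \near x, f y = g y) -> {for x, continuous f} ->
  {for x, continuous g}.
Proof.
move=> E c; have E0 : f x = g x := nbhs_singleton E.
have c' : f @ x --> g x by rewrite -E0.
exact: cvg_trans (near_eq_cvg E) c'.
Qed.

Section TangentMaps.
Variable R : realType.
Local Notation V := 'rV[R]_3.
Local Notation T := (torus R).
Implicit Types (x y v : V) (f g h : T -> T) (F G : V -> V).

Lemma tprojP x y :
  tproj x = tproj y <-> exists k : 'rV[int]_3, x - y = map_mx intr k.
Proof.
split=> [/eqmodP /asboolP //|h]; apply/eqmodP; exact/asboolP.
Qed.

Lemma treprK (p : T) : tproj (trepr p) = p.
Proof. exact: reprK. Qed.

Lemma tprojD x (k : 'rV[int]_3) : tproj (x + map_mx intr k) = tproj x.
Proof. by apply/tprojP; exists k; rewrite addrC addKr. Qed.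

Lemma row_normP n (v : 'rV[R]_n) (e : R) :
  reflect (0 <= e /\ forall i, `|v 0 i| <= e) (`|v| <= e).
Proof.
apply: (iffP idP) => [h|[e0 h]].
  have e0 : 0 <= e by apply: le_trans h.
  split=> // i; apply: le_trans h.
  rewrite [leRHS]/Num.Def.normr/= mx_normrE.
  exact: (le_bigmax _ (fun ij => `|v ij.1 ij.2|) (0, i)).
rewrite [leLHS]/Num.Def.normr/= mx_normrE.
by apply: bigmax_le => // -[i j] _; rewrite (ord1 i).
Qed.

(** Distinct lattice points are at sup-distance at least 1.  Hence two local lifts
    of the same torus map differ by a constant, which is why the tangent map does
    not depend on the lift. *)
Lemma lattice_valued_locally_constant (h : V -> V) x : {for x, continuous h} ->
  (\forall y \near x, exists k : 'rV[int]_3, h y = map_mx intr k) ->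
  \forall y \near x, h y = h x.
Proof.
move=> hc hl; have [k0 hk0] := nbhs_singleton hl.
have half0 : (0 : R) < 1 / 2 by lra.
move/cvgrPdist_le: hc => /(_ _ half0) hc.
near=> y.
have : `|h x - h y| <= 1 / 2 by near: y.
have [k hk] : exists k : 'rV[int]_3, h y = map_mx intr k by near: y.
move=> /row_normP[_ hn]; rewrite hk hk0; apply/rowP => i; rewrite !mxE.
have := hn i; rewrite hk hk0 !mxE -intrB -intr_norm => hi.
have : `|k0 0 i - k 0 i| < 1.
  by rewrite -(ltr_int R); apply: le_lt_trans hi _; lra.
by move=> ?; congr (_%:~R); lia.
Unshelve. all: by end_near. Qed.

Lemma eq_mulrow (A B : 'M[R]_3) : (forall v : V, v *m A = v *m B) -> A = B.
Proof. by move=> h; apply/row_matrixP => i; rewrite rowE h -rowE. Qed.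

Lemma mulrow_jacobian_diff F x v : v *m jacobian F x = 'd F x v.
Proof. by rewrite /jacobian mul_rV_lin1. Qed.

Lemma mulrow_jacobian F x v :
  differentiable F x -> v *m jacobian F x = 'D_v F x.
Proof. by move=> dF; rewrite deriveE// /jacobian mul_rV_lin1. Qed.

(** A relational form of [tangent] at a point of the covering space, for an
    arbitrary representative of the point of the torus. *)
Definition is_tangent f x (A : 'M[R]_3) := exists F : V -> V,
  [/\ \forall y \near x, tproj (F y) = f (tproj y),
      differentiable F x & A = jacobian F x].

Lemma is_tangent_unique f x A B : is_tangent f x A -> is_tangent f x B -> A = B.
Proof.
move=> [F [hF dF ->]] [G [hG dG ->]].
have dFG : differentiable (F - G) x by exact: differentiableB.
have loc : \forall y \near x, (F - G) y = (F - G) x.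
  apply: lattice_valued_locally_constant.
    exact: differentiable_continuous.
  near=> y; apply/tprojP.
  by transitivity (f (tproj y)); [|symmetry]; near: y.
apply: eq_mulrow => v.
apply: (etrans (mulrow_jacobian v dF)); apply: esym.
apply: (etrans (mulrow_jacobian v dG)); apply: esym.
apply/eqP; rewrite -subr_eq0.
rewrite -deriveB; [|exact: diff_derivable|exact: diff_derivable].
rewrite (near_eq_derive (g := cst ((F - G) x)))//.
by rewrite derive_cst.
Unshelve. all: by end_near. Qed.

Lemma is_tangent_shift f x y A : tproj x = tproj y ->
  is_tangent f x A -> is_tangent f y A.
Proof.
move=> /tprojP[k xy] [F [hF dF ->]].
pose s (z : V) := z + map_mx intr k.
have sy : s y = x by rewrite /s -xy addrC subrK.
have ds : is_diff y s (id + (0 : V -> V)).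
  by apply: is_diffD; apply: is_diff_id.
have ds' : differentiable s y by case: ds.
have dFs : differentiable F (s y) by rewrite sy.
exists (F \o s); split.
- have : \forall z \near x, tproj (F z) = f (tproj z) by [].
  rewrite -sy => hF'.
  have cs : {for y, continuous s}.
    by apply: differentiable_continuous; case: ds.
  have hs : \forall z \near y, tproj (F (s z)) = f (tproj (s z)).
    exact: (cs _ hF').
  near=> z; rewrite -(tprojD z k); near: z; exact: hs.
- exact: (differentiable_comp ds' dFs).
- apply: eq_mulrow => v.
  apply: (etrans (mulrow_jacobian_diff F x v)); apply: esym.
  apply: (etrans (mulrow_jacobian_diff (F \o s) y v)).
  apply: (etrans (congr1 (fun L : V -> V => L v) (diff_comp ds' dFs))).
  rewrite [LHS]/= sy; congr ('d F x _).
  apply: (etrans (congr1 (fun L : V -> V => L v) (@diff_val _ _ _ _ _ _ _ ds))).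
  by rewrite [LHS]addr0.
Unshelve. all: by end_near. Qed.

(** The lift of [g] may be taken at any representative [y] of the image point; it is
    moved to the point [F x] by a lattice translation. *)
Lemma is_tangent_comp f g x y A B : tproj y = f (tproj x) ->
  is_tangent f x A -> is_tangent g y B -> is_tangent (g \o f) x (A *m B).
Proof.
move=> yfx [F [hF dF ->]] hg.
have [G [hG dG ->]] : is_tangent g (F x) B.
  by apply: is_tangent_shift hg; rewrite (nbhs_singleton hF).
exists (G \o F); split.
- have cF := differentiable_continuous dF.
  near=> z => /=; rewrite -(near hF z)//.
  by near: z; exact: (cF _ hG).
- exact: (differentiable_comp dF dG).
- apply: eq_mulrow => v; rewrite mulmxA.
  apply: (etrans (congr1 (fun w : V => w *m jacobian G (F x))
    (mulrow_jacobian_diff F x v))).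
  apply: (etrans (mulrow_jacobian_diff G (F x) _)); apply: esym.
  apply: (etrans (mulrow_jacobian_diff (G \o F) x v)).
  exact: (congr1 (fun L : V -> V => L v) (diff_comp dF dG)).
Unshelve. all: by end_near. Qed.

Lemma tangentE f x A : is_tangent f x A -> tangent f (tproj x) = A.
Proof.
move=> h; have h' : is_tangent f (trepr (tproj x)) A.
  by apply: is_tangent_shift h; rewrite treprK.
rewrite /tangent; case: xgetP => [B _ hB|/(_ A)//].
exact: is_tangent_unique hB h'.
Qed.

Lemma is_tangent_id x : is_tangent id x 1%:M.
Proof.
exists id; split; [by near=> y|by []|].
apply: eq_mulrow => v; rewrite mulmx1; apply: esym.
apply: (etrans (mulrow_jacobian_diff id x v)).
by rewrite diff_val.
Unshelve. all: by end_near. Qed.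

Lemma C1_is_tangent f x : torus_Ck 1 f -> is_tangent f x (tangent f (tproj x)).
Proof.
move=> /(_ x) [U [F [oU Ux hF [dF _]]]].
have h : is_tangent f x (jacobian F x).
  exists F; split=> //; last exact: dF.
  by apply: filterS hF _; exact: open_nbhs_nbhs.
by rewrite (tangentE h).
Qed.

Lemma C1_tangent_comp f g p : torus_Ck 1 f -> torus_Ck 1 g ->
  tangent (g \o f) p = tangent f p *m tangent g (f p).
Proof.
move=> hf hg; rewrite -(treprK p); apply: tangentE.
apply: (is_tangent_comp (y := trepr (f (tproj (trepr p))))).
- by rewrite treprK.
- exact: C1_is_tangent.
- by rewrite -[in tangent g _](treprK (f _)); exact: C1_is_tangent.
Qed.

Lemma tangent_id p : tangent (@id T) p = 1%:M.
Proof. by rewrite -(treprK p) (tangentE (is_tangent_id _)). Qed.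

(** Fields on the torus are handled through their lifts to the covering space. *)
Definition lift_continuous (W : topologicalType) (s : T -> W) :=
  continuous (s \o @tproj R).

(** The rows of the Jacobian are the directional derivatives, which are continuous
    by the definition of a C^1 map. *)
Lemma C1_tangent_entry_continuous f i j : torus_Ck 1 f ->
  lift_continuous (fun p => tangent f p i j : R).
Proof.
move=> hf x; have [U [F [oU Ux hF [dF cF]]]] := hf x.
have nU : \forall y \near x, U y by exact: open_nbhs_nbhs.
have E : \forall y \near x, ('D_(delta_mx 0 i) F y) 0 j = tangent f (tproj y) i j.
  near=> y; have Uy : U y by near: y.
  rewrite (@tangentE _ _ (jacobian F y)); last first.
    exists F; split=> //; last exact: dF.
    by apply: filterS hF _; exact: open_nbhs_nbhs.
  rewrite -(mulrow_jacobian _ (dF y Uy)) -rowE mxE.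
  by [].
have c : {for x, continuous (fun y => ('D_(delta_mx 0 i) F y) 0 j)}.
  apply: (@continuous_comp _ _ _ ('D_(delta_mx 0 i) F) (fun M : V => M 0 j)).
    exact: (cF (delta_mx 0 i) x Ux).
  exact: (@coord_continuous R 1 3 0 j).
exact: (continuous_near_eq E c).
Unshelve. all: by end_near. Qed.

Lemma C1_lift_continuous_comp (W : topologicalType) (s : T -> W) f :
  torus_Ck 0 f -> lift_continuous s -> lift_continuous (s \o f).
Proof.
move=> hf hs x; have [U [F [oU Ux hF cF]]] := hf x.
have E : \forall y \near x, (s \o @tproj R) (F y) = s (f (tproj y)).
  near=> y; rewrite /= hF//; near: y; exact: open_nbhs_nbhs.
apply: (continuous_near_eq E).
exact: (@continuous_comp _ _ _ F (s \o @tproj R) x (cF _ Ux) (hs (F x))).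
Unshelve. all: by end_near. Qed.

Lemma torus_C1_C0 f : torus_Ck 1 f -> torus_Ck 0 f.
Proof.
move=> h x; have [U [F [oU Ux hF [dF _]]]] := h x.
by exists U, F; split=> // y Uy; exact/differentiable_continuous/dF.
Qed.

End TangentMaps.

(** * Sections invariant under fibre contractions *)

Section InvariantSection.
Variables (R : realType) (n0 : nat).
Local Notation V := 'rV[R]_3.
Local Notation T := (torus R).
Local Notation W := 'rV[R]_n0.
Variables (h : T -> T) (Phi : T -> W -> W) (rho kappa : R).

(** The graph transform: iterating [s |-> Phi _ (s (h _))] from the zero section
    converges uniformly at a geometric rate, so the limit is continuous and
    invariant. *)
Lemma invariant_section :
  0 <= rho -> 0 <= kappa < 1 ->
  (forall p w, `|w| <= rho -> `|Phi p w| <= rho) ->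
  (forall p w w', `|w| <= rho -> `|w'| <= rho ->
     `|Phi p w - Phi p w'| <= kappa * `|w - w'|) ->
  (forall s : T -> W, lift_continuous s -> (forall p, `|s p| <= rho) ->
     lift_continuous (fun p => Phi p (s (h p)))) ->
  exists s : T -> W, [/\ lift_continuous s, forall p, `|s p| <= rho
    & forall p, s p = Phi p (s (h p))].
Proof.
move=> rho0 /andP[k0 k1] ball lip cont.
pose u n : T -> W := iter n (fun s p => Phi p (s (h p))) (fun=> 0).
have uB n p : `|u n p| <= rho.
  by elim: n p => [|n IH] p; rewrite /= ?normr0//; exact: ball.
have uD n m p : `|u (n + m)%N p - u n p| <= kappa ^+ n * (2 * rho).
  elim: n p => [|n IH] p.
    rewrite add0n expr0 mul1r subr0.
    by apply: le_trans (uB m p) _; lra.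
  rewrite addSn exprS -mulrA; apply: le_trans (lip _ _ _ _ _) _; rewrite ?uB//.
  exact: ler_wpM2l.
have geo : (fun n => kappa ^+ n * (2 * rho)) @ \oo --> (0 : R).
  rewrite -[X in _ --> X](mul0r (2 * rho)); apply: cvgMl.
  by apply: cvg_expr; rewrite ger0_norm.
have ucvg p : cvg (u ^~ p @ \oo).
  apply/cauchy_cvgP/cauchyP => e e0.
  (* All the iterates after [N] are within the geometric bound of the [N]-th one. *)
  move/cvgrPdist_lt: geo => /(_ _ e0)[N _ /(_ N (leqnn N))].
  rewrite sub0r normrN => /(le_lt_trans (ler_norm _)) hN.
  exists (u N p); exists N => // m /= Nm.
  rewrite -ball_normE /= distrC -(subnKC Nm).
  exact: le_lt_trans (uD _ _ _) hN.
pose s p : W := lim (u ^~ p @ \oo).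
have sD n p : `|s p - u n p| <= kappa ^+ n * (2 * rho).
  apply/ler_addgt0Pr => e e0.
  have /cvgrPdist_le/(_ _ e0) [N _ hN] : u ^~ p @ \oo --> s p by exact: ucvg.
  have {}hN : `|s p - u (n + N)%N p| <= e := hN (n + N)%N (leq_addl _ _).
  rewrite -(subrKA (u (n + N)%N p)); apply: le_trans (ler_normD _ _) _.
  by rewrite addrC lerD ?uD.
have usmall (e : R) : 0 < e ->
    exists n, forall p, `|s p - u n p| <= e /\ `|s p - u n.+1 p| <= e.
  move=> e0; move/cvgrPdist_le: geo => /(_ _ e0)[N _ /(_ N (leqnn N))].
  rewrite sub0r normrN => /(le_trans (ler_norm _)) hN.
  exists N => p; split; apply: le_trans (sD _ _) _; rewrite // exprS -mulrA.
  apply: le_trans hN; rewrite ler_piMl ?mulr_ge0 ?exprn_ge0 ?(ltW k1)//.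
have sB p : `|s p| <= rho.
  apply/ler_addgt0Pr => e e0; have [n hn] := usmall e e0.
  rewrite -(subrK (u n p) (s p)) addrC; apply: le_trans (ler_normD _ _) _.
  by rewrite lerD//; case: (hn p).
have ucont n : lift_continuous (u n).
  elim: n => [|n IH]; first exact: cst_continuous.
  by apply: cont.
have scont : lift_continuous s.
  move=> x; apply/(@cvgrPdist_le R W V (nbhs x)) => e e0.
  have e3 : 0 < e / 3 by lra.
  have [n hn] := usmall _ e3.
  have /(@cvgrPdist_le R W V (nbhs x))/(_ _ e3) hu := ucont n x.
  near=> y; rewrite /=.
  have [h1 _] := hn (tproj x); have [h2 _] := hn (tproj y).
  have h3 : `|u n (tproj x) - u n (tproj y)| <= e / 3 by near: y.
  rewrite -(subrKA (u n (tproj x))) -(subrKA (u n (tproj y)) (u n (tproj x))).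
  apply: le_trans (ler_normD _ _) _.
  have h4 := le_trans (ler_normD (u n (tproj x) - u n (tproj y))
     (u n (tproj y) - s (tproj y))) (lexx _).
  rewrite distrC in h2; lra.
exists s; split=> // p; apply/eqP; rewrite -subr_eq0 -normr_le0.
apply/ler_addgt0Pr => e e0; rewrite add0r.
have e2 : 0 < e / 2 by lra.
have [n hn] := usmall _ e2.
have [[_ h1] [h2 _]] := (hn p, hn (h p)).
rewrite -(subrKA (u n.+1 p)); apply: le_trans (ler_normD _ _) _.
have h3 : `|u n.+1 p - Phi p (s (h p))| <= e / 2.
  rewrite /= distrC; apply: le_trans (lip _ _ _ _ _) _; rewrite ?uB//.
  by apply: le_trans h2; rewrite ler_piMl ?(ltW k1).
lra.
Unshelve. all: by end_near. Qed.
End InvariantSection.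

(** * Cone fields *)

Lemma ord3P (i : 'I_3) : [\/ i = i0, i = i1 | i = i2].
Proof.
case: i => -[|[|[|//]]] h; [apply: Or31|apply: Or32|apply: Or33]; exact: val_inj.
Qed.

Lemma big_ord3 (K : nmodType) (F : 'I_3 -> K) :
  \sum_i F i = F i0 + F i1 + F i2.
Proof.
rewrite !big_ord_recr big_ord0 /= add0r.
by congr (F _ + F _ + F _); exact: val_inj.
Qed.

Section LiftContinuity.
Variable R : realType.
Local Notation V := 'rV[R]_3.
Local Notation T := (torus R).
Implicit Types u v : T -> R.

Lemma lift_continuousD u v : lift_continuous u -> lift_continuous v ->
  lift_continuous (fun p => u p + v p).
Proof. by move=> hu hv x; exact: cvgD (hu x) (hv x). Qed.

Lemma lift_continuousM u v : lift_continuous u -> lift_continuous v ->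
  lift_continuous (fun p => u p * v p).
Proof. by move=> hu hv x; exact: cvgM (hu x) (hv x). Qed.

Lemma lift_continuous_div u v : lift_continuous u -> lift_continuous v ->
  (forall p, v p != 0) -> lift_continuous (fun p => u p / v p).
Proof.
by move=> hu hv v0 x; exact: cvgM (hu x) (cvgV (v0 (tproj x)) (hv x)).
Qed.

Lemma lift_continuous_cst (c : R) : lift_continuous (fun _ : T => c).
Proof. exact: cst_continuous. Qed.

Lemma continuous_row (U : topologicalType) n (w : U -> 'rV[R]_n) x :
  (forall j, {for x, continuous (fun y => w y 0 j)}) -> {for x, continuous w}.
Proof.
move=> h; apply/cvgrPdist_le => e e0; near=> y.
apply/row_normP; split=> [|j]; first exact: ltW.
rewrite !mxE; move: j; near: y; apply: filter_forall => j.
have /cvgrPdist_le/(_ _ e0) := h j; exact.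
Unshelve. all: by end_near. Qed.

Lemma lift_continuous_coord n (w : T -> 'rV[R]_n) j : lift_continuous w ->
  lift_continuous (fun p => w p 0 j).
Proof.
move=> hw x.
apply: (@continuous_comp _ _ _ (w \o @tproj R) (fun M : 'rV_n => M 0 j)).
  exact: hw.
exact: (@coord_continuous R 1 n 0 j).
Qed.

End LiftContinuity.

Section Cone.
Variable R : realType.
Local Notation V := 'rV[R]_3.
Local Notation T := (torus R).

(** The representative of a line close to the first basis vector; the line field and
    the conormals of the plane field are both described by such rows. *)
Definition graph_row (a b : R) : V := \row_j [:: 1; a; b]`_j.

(** The first coordinate is expanded by more than 2 while the lower-right block has
    column sums at most 11/10; rows in the cone |a|, |b| <= 1/10 are then mapped
    into this cone. *)
Definition cone_mx (C : 'M[R]_3) := [/\ 11/5 <= C i0 i0,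
  `|C i0 i1| <= 9/100 /\ `|C i0 i2| <= 9/100,
  `|C i1 i0| <= 9/100 /\ `|C i2 i0| <= 9/100
  & `|C i1 i1| + `|C i2 i1| <= 11/10 /\ `|C i1 i2| + `|C i2 i2| <= 11/10].

Let den (C : 'M[R]_3) a b := C i0 i0 + a * C i1 i0 + b * C i2 i0.
Let num (C : 'M[R]_3) j a b := C i0 j + a * C i1 j + b * C i2 j.

Lemma graph_row_mulE (C : 'M[R]_3) a b j :
  (graph_row a b *m C) 0 j = num C j a b.
Proof. by rewrite mxE big_ord3 !mxE /= mul1r. Qed.

Lemma ler_norm_mul (x y c d : R) : `|x| <= c -> `|y| <= d -> `|x * y| <= c * d.
Proof. by move=> hx hy; rewrite normrM; apply: ler_pM. Qed.

Lemma den_ge C a b : cone_mx C -> `|a| <= 1/10 -> `|b| <= 1/10 ->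
  109/50 <= den C a b.
Proof.
move=> [h0 _ [h1 h2] _] ha hb.
have := ler_norm_mul ha h1; have := ler_norm_mul hb h2.
rewrite /den !ler_norml => /andP[+ _] /andP[+ _]; lra.
Qed.

Lemma num_le C a b j : cone_mx C -> `|a| <= 1/10 -> `|b| <= 1/10 ->
  j = i1 \/ j = i2 -> `|num C j a b| <= 1/5.
Proof.
move=> [_ [h1 h2] _ [h3 h4]] ha hb hj.
have h : `|C i0 j| <= 9/100 /\ `|C i1 j| + `|C i2 j| <= 11/10 by case: hj => ->.
case: h => h5 h6.
apply: le_trans (ler_normD _ _) _; apply: le_trans (lerD (ler_normD _ _) (lexx _)) _.
have := ler_norm_mul ha (lexx `|C i1 j|); have := ler_norm_mul hb (lexx `|C i2 j|).
lra.
Qed.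

(** The projective action on slopes contracts the sup norm by 3/5: the numerators
    have Lipschitz constant 11/10, the denominators are at least 2.18, and the
    variation of the denominators is damped by the bound 1/10 on the slopes. *)
Lemma slope_lip C a b a' b' d j : cone_mx C -> `|a| <= 1/10 -> `|b| <= 1/10 ->
  `|a'| <= 1/10 -> `|b'| <= 1/10 -> j = i1 \/ j = i2 ->
  `|a - a'| <= d -> `|b - b'| <= d ->
  `|num C j a b / den C a b - num C j a' b' / den C a' b'| <= 3/5 * d.
Proof.
move=> hC ha hb ha' hb' hj hda hdb.
have d0 : 0 <= d by apply: le_trans hda.
have D1 := den_ge hC ha hb; have D2 := den_ge hC ha' hb'.
have N2 := num_le hC ha' hb' hj.
case: (hC) => [_ _ [h1 h2] [h3 h4]].
have h5 : `|C i1 j| + `|C i2 j| <= 11/10 by case: hj => ->.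
set D := den C a b in D1 *; set D' := den C a' b' in D2 *.
set N' := num C j a' b' in N2 *; set N := num C j a b.
have D0 : D != 0 by rewrite gt_eqF//; lra.
have D0' : D' != 0 by rewrite gt_eqF//; lra.
have -> : N / D - N' / D' = ((N - N') - (N' / D') * (D - D')) / D.
  by field; apply/andP.
(* The image slope stays in the cone, which damps the variation of the denominator. *)
have q : `|N' / D'| <= 1/10.
  rewrite normrM normfV (ger0_norm (x := D')); last lra.
  rewrite ler_pdivrMr; lra.
have hN : `|N - N'| <= 11/10 * d.
  have -> : N - N' = (a - a') * C i1 j + (b - b') * C i2 j.
    by rewrite /N /N' /num; ring.
  apply: le_trans (ler_normD _ _) _.
  have := ler_norm_mul hda (lexx `|C i1 j|); have := ler_norm_mul hdb (lexx `|C i2 j|).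
  have := ler_wpM2l d0 h5; lra.
have hD : `|D - D'| <= 18/100 * d.
  have -> : D - D' = (a - a') * C i1 i0 + (b - b') * C i2 i0.
    by rewrite /D /D' /den; ring.
  apply: le_trans (ler_normD _ _) _.
  have := ler_norm_mul hda h1; have := ler_norm_mul hdb h2; lra.
rewrite normrM normfV (ger0_norm (x := D)); last lra.
rewrite ler_pdivrMr; last lra.
apply: le_trans (ler_normB _ _) _.
have := ler_norm_mul q hD.
have : 0 <= d * (D - 109/50) by rewrite mulr_ge0//; lra.
lra.
Qed.

(** [C p] maps the fibre over [h p] to the fibre over [p].  Forward cocycles are
    covered by taking [h] to be the inverse of the dynamics, and cocycles of
    transposes by taking [h] to be the dynamics. *)
Lemma cone_section (h : T -> T) (C : T -> 'M[R]_3) :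
  (forall u : T -> R, lift_continuous u -> lift_continuous (u \o h)) ->
  (forall p, cone_mx (C p)) ->
  (forall i j, lift_continuous (fun p => C p i j)) ->
  exists a b t : T -> R, [/\ lift_continuous a, lift_continuous b,
    forall p, `|a p| <= 1/10 /\ `|b p| <= 1/10, forall p, 109/50 <= t p
    & forall p, graph_row (a (h p)) (b (h p)) *m C p
        = t p *: graph_row (a p) (b p)].
Proof.
move=> hc hC cC.
pose o0 : 'I_2 := @Ordinal 2 0 isT; pose o1 : 'I_2 := @Ordinal 2 1 isT.
pose Phi p (w : 'rV[R]_2) : 'rV[R]_2 := \row_j
  (num (C p) (if j == o0 then i1 else i2) (w 0 o0) (w 0 o1)
   / den (C p) (w 0 o0) (w 0 o1)).
have jc (j : 'I_2) : (if j == o0 then i1 else i2) = i1 \/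
    (if j == o0 then i1 else i2) = i2 by case: ifP; [left|right].
have cnum j u v : lift_continuous u -> lift_continuous v ->
    lift_continuous (fun p : T => num (C p) j (u p) (v p)).
  move=> hu hv; apply: lift_continuousD (lift_continuousM hv (cC _ _)).
  exact: lift_continuousD (cC _ _) (lift_continuousM hu (cC _ _)).
have [||p w hw|p w w' hw hw'|s hs sB|s [cs sB sE]] :=
  @invariant_section R 2 h Phi (1/10) (3/5).
- lra.
- lra.
- move/row_normP: hw => [_ hw]; apply/row_normP; split=> [|j]; first lra.
  rewrite mxE; have D := den_ge (hC p) (hw o0) (hw o1).
  have N := num_le (hC p) (hw o0) (hw o1) (jc j).
  rewrite normrM normfV (ger0_norm (x := den _ _ _)); last lra.
  rewrite ler_pdivrMr; lra.
- move/row_normP: hw => [_ hw]; move/row_normP: hw' => [_ hw'].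
  have /row_normP[_ hd] : `|w - w'| <= `|w - w'| by [].
  apply/row_normP; split=> [|j]; first by rewrite mulr_ge0//; lra.
  rewrite !mxE; apply: slope_lip => //.
  + by have := hd o0; rewrite !mxE.
  + by have := hd o1; rewrite !mxE.
- move=> x; apply: continuous_row => j.
  have e : (fun y => (Phi (tproj y) (s (h (tproj y)))) 0 j) =
    (fun p => num (C p) (if j == o0 then i1 else i2) (s (h p) 0 o0) (s (h p) 0 o1)
      / den (C p) (s (h p) 0 o0) (s (h p) 0 o1)) \o @tproj R.
    by apply/funext => y; rewrite /= mxE.
  rewrite /= e; move: x.
  have cu k : lift_continuous (fun p => s (h p) 0 k).
    by apply: (hc (fun p => s p 0 k)); exact: lift_continuous_coord.
  apply: lift_continuous_div; [exact: cnum|exact: cnum|move=> p].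
  have /row_normP[_ hw] := sB (h p).
  by have := den_ge (hC p) (hw o0) (hw o1); move=> ?; rewrite gt_eqF//; lra.
exists (fun p => s p 0 o0), (fun p => s p 0 o1),
  (fun p => den (C p) (s (h p) 0 o0) (s (h p) 0 o1)).
have tE p : 109/50 <= den (C p) (s (h p) 0 o0) (s (h p) 0 o1).
  by have /row_normP[_ hw] := sB (h p); exact: den_ge.
split=> //.
- exact: lift_continuous_coord.
- exact: lift_continuous_coord.
- by move=> p; have /row_normP[_ hw] := sB p.
- move=> p; apply/rowP => j; rewrite graph_row_mulE !mxE.
  have D0 : den (C p) (s (h p) 0 o0) (s (h p) 0 o1) != 0.
    by have := tE p => ?; rewrite gt_eqF//; lra.
  case: (ord3P j) => -> /=.
  + by rewrite mulr1.
  + by rewrite (sE p) mxE /= [RHS]mulrC divfK.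
  + by rewrite (sE p) mxE /= [RHS]mulrC divfK.
Qed.

End Cone.

(** * Iterated tangent maps and the Euclidean norm *)

Lemma unitmxM (K : fieldType) n (A B : 'M[K]_n) :
  A \in unitmx -> B \in unitmx -> A *m B \in unitmx.
Proof. by move=> uA uB; rewrite unitmx_mul uA. Qed.

Section Iterates.
Variable R : realType.
Local Notation V := 'rV[R]_3.
Local Notation T := (torus R).
Variable g : T -> T.

(** Differentiability on the whole torus, in the form that is stable under
    iteration by the chain rule. *)
Definition has_tangents := forall x, is_tangent g x (tangent g (tproj x)).

Hypothesis tg : has_tangents.

Lemma is_tangent_iter n x : is_tangent (iter n g) x (tangent (iter n g) (tproj x)).
Proof.
elim: n x => [|n IH] x.
  by rewrite (tangentE (is_tangent_id x)); exact: is_tangent_id.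
have h : is_tangent (iter n.+1 g) x
    (tangent (iter n g) (tproj x) *m tangent g (iter n g (tproj x))).
  apply: (is_tangent_comp (y := trepr (iter n g (tproj x)))) (IH x) _.
    exact: treprK.
  by rewrite -[in tangent g _](treprK (iter n g _)); exact: tg.
by rewrite (tangentE h).
Qed.

Lemma tangent_iterS n p : tangent (iter n.+1 g) p =
  tangent (iter n g) p *m tangent g (iter n g p).
Proof.
rewrite -(treprK p); apply: tangentE.
apply: (is_tangent_comp (y := trepr (iter n g (tproj (trepr p))))).
- exact: treprK.
- exact: is_tangent_iter.
- by rewrite -[in tangent g _](treprK (iter n g _)); exact: tg.
Qed.

Lemma tangent_iter_unit n p : (forall q, tangent g q \in unitmx) ->
  tangent (iter n g) p \in unitmx.
Proof.
move=> gu; elim: n => [|n IH]; first by rewrite tangent_id unitmx1.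
by rewrite (tangent_iterS n p); exact: unitmxM IH (gu _).
Qed.

Variable E : T -> 'M[R]_3.
Hypothesis Einv : forall p (v : V),
  (v <= E p)%MS -> (v *m tangent g p <= E (g p))%MS.

Lemma iter_invariant n p (v : V) : (v <= E p)%MS ->
  (v *m tangent (iter n g) p <= E (iter n g p))%MS.
Proof.
move=> vE; elim: n => [|n IH]; first by rewrite tangent_id mulmx1.
by rewrite tangent_iterS mulmxA; exact: Einv.
Qed.

Lemma iter_expansion s : 0 <= s ->
  (forall p (v : V), (v <= E p)%MS -> s * enorm v <= enorm (v *m tangent g p)) ->
  forall n p (v : V), (v <= E p)%MS ->
    s ^+ n * enorm v <= enorm (v *m tangent (iter n g) p).
Proof.
move=> s0 h n p v vE; elim: n => [|n IH].
  by rewrite tangent_id mulmx1 expr0 mul1r.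
rewrite tangent_iterS mulmxA exprS -mulrA.
by apply: le_trans (h _ _ (iter_invariant n vE)); rewrite ler_wpM2l.
Qed.

Lemma iter_contraction s : 0 <= s ->
  (forall p (v : V), (v <= E p)%MS -> enorm (v *m tangent g p) <= s * enorm v) ->
  forall n p (v : V), (v <= E p)%MS ->
    enorm (v *m tangent (iter n g) p) <= s ^+ n * enorm v.
Proof.
move=> s0 h n p v vE; elim: n => [|n IH].
  by rewrite tangent_id mulmx1 expr0 mul1r.
rewrite tangent_iterS mulmxA exprS -mulrA.
by apply: le_trans (h _ _ (iter_invariant n vE)) _; rewrite ler_wpM2l.
Qed.

End Iterates.

Section EuclideanNorm.
Variable R : realType.
Local Notation V := 'rV[R]_3.

Lemma enormE (v : V) :
  enorm v = Num.sqrt (v 0 i0 ^+ 2 + v 0 i1 ^+ 2 + v 0 i2 ^+ 2).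
Proof. by rewrite /enorm big_ord3. Qed.

Lemma enorm_mx (v : V) : enorm v = Num.sqrt ((v *m v^T) 0 0).
Proof.
rewrite /enorm mxE; congr (Num.sqrt _).
by apply: eq_bigr => i _; rewrite mxE expr2.
Qed.

Lemma enorm_isometry (P : 'M[R]_3) (v : V) : P *m P^T = 1%:M ->
  enorm (v *m P) = enorm v.
Proof. by move=> PP; rewrite !enorm_mx trmx_mul mulmxA -(mulmxA v) PP mulmx1. Qed.

Lemma enorm_ge0 (v : V) : 0 <= enorm v.
Proof. exact: sqrtr_ge0. Qed.

Lemma enormZ k (v : V) : enorm (k *: v) = `|k| * enorm v.
Proof.
rewrite /enorm -sqrtr_sqr -sqrtrM ?sqr_ge0//; congr Num.sqrt.
by rewrite mulr_sumr; apply: eq_bigr => i _; rewrite mxE exprMn.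
Qed.

Lemma enorm_gt0 (v : V) : (0 < enorm v) = (v != 0).
Proof.
rewrite sqrtr_gt0 lt_neqAle eq_sym sumr_ge0 ?andbT => [|i _]; last exact: sqr_ge0.
congr (~~ _); rewrite psumr_eq0 => [|i _]; last exact: sqr_ge0.
apply/allP/eqP => [h|-> i _]; last by rewrite mxE expr0n eqxx.
apply/rowP => i; rewrite mxE; apply/eqP.
by have := h i (mem_index_enum i); rewrite sqrf_eq0.
Qed.

Lemma enorm_le (v w : V) k : 0 <= k ->
  w 0 i0 ^+ 2 + w 0 i1 ^+ 2 + w 0 i2 ^+ 2 <=
    k ^+ 2 * (v 0 i0 ^+ 2 + v 0 i1 ^+ 2 + v 0 i2 ^+ 2) ->
  enorm w <= k * enorm v.
Proof.
move=> k0 h; rewrite !enormE -[k in X in _ <= X](ger0_norm k0) -sqrtr_sqr.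
by rewrite -sqrtrM ?sqr_ge0// ler_sqrt// mulr_ge0 ?addr_ge0 ?sqr_ge0.
Qed.

End EuclideanNorm.

(** * Line and plane frames, one-step estimates *)

Section Frames.
Variable R : realType.
Local Notation V := 'rV[R]_3.

(** The plane of the rows orthogonal to [graph_row c d]. *)
Definition cs_frame (c d : R) : 'M[R]_(2, 3) :=
  \matrix_(i, j) (nth [::] [:: [:: - c; 1; 0]; [:: - d; 0; 1]] i)`_j.

Lemma big_ord2 (K : nmodType) (F : 'I_2 -> K) : \sum_i F i = F j0 + F j1.
Proof.
by rewrite !big_ord_recr big_ord0 /= add0r; congr (F _ + F _); exact: val_inj.
Qed.

Lemma graph_row_affine (a b : R) : graph_row a b =
  graph_row 0 0 + a *: (delta_mx 0 i1 : V) + b *: (delta_mx 0 i2 : V).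
Proof.
by apply/rowP => j; rewrite !mxE; case: (ord3P j) => -> /=;
  rewrite ?mulr0 ?mulr1 ?addr0 ?add0r.
Qed.

Lemma cs_frame_affine (c d : R) : cs_frame c d = cs_frame 0 0
  + (- c) *: (delta_mx j0 i0 : 'M[R]_(2, 3)) + (- d) *: (delta_mx j1 i0 : 'M[R]_(2, 3)).
Proof.
apply/matrixP => i j; rewrite !mxE.
by case: i => -[|[|//]] hi; case: (ord3P j) => -> /=;
  rewrite ?mulr0 ?mulr1 ?oppr0 ?addr0 ?add0r.
Qed.

Lemma cs_frame_memP (x : V) (c d : R) :
  reflect (x 0 i0 = - c * x 0 i1 - d * x 0 i2) (x <= cs_frame c d)%MS.
Proof.
apply: (iffP submxP) => [[D ->]|h].
  rewrite !mxE !big_ord2 !mxE /=; ring.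
exists (\row_j [:: x 0 i1; x 0 i2]`_j).
apply/rowP => j; rewrite mxE big_ord2 !mxE /=.
case: (ord3P j) => -> /=; last 2 first; [ring|ring|rewrite h; ring].
Qed.

(** Invariance of the planes becomes invariance of their conormals under the
    transposed cocycle. *)
Lemma cs_frame_orthoP (x : V) (c d : R) :
  reflect (x *m (graph_row c d)^T = 0) (x <= cs_frame c d)%MS.
Proof.
have E : (x *m (graph_row c d)^T) 0 0 = x 0 i0 + c * x 0 i1 + d * x 0 i2.
  by rewrite mxE big_ord3 !mxE /=; ring.
apply: (iffP (cs_frame_memP _ _ _)) => h.
  by apply/rowP => j; rewrite (ord1 j) E h mxE; ring.
have : x 0 i0 + c * x 0 i1 + d * x 0 i2 = 0 by rewrite -E h mxE.
lra.
Qed.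

Lemma rank_graph_row (a b : R) : \rank (graph_row a b) = 1%N.
Proof.
rewrite rank_rV; case: eqP => // /rowP /(_ i0); rewrite !mxE /= => /eqP.
by rewrite oner_eq0.
Qed.

Lemma rank_cs_frame (c d : R) : \rank (cs_frame c d) = 2%N.
Proof.
apply/eqP; rewrite -[_ == _]/(row_free _); apply/row_freeP.
exists (\matrix_(i, j) ((i : nat) == j.+1)%:R).
apply/matrixP => i j; rewrite mxE big_ord3 !mxE /=.
case: i => -[|[|//]] hi; case: j => -[|[|//]] hj /=;
 by rewrite ?(mulr0, mulr1, addr0, add0r).
Qed.

Lemma continuous_affine_frame (U : topologicalType) m (N0 N1 N2 : 'M[R]_(m, 3))
   (u v : U -> R) x : {for x, continuous u} -> {for x, continuous v} ->
  {for x, continuous (fun y => N0 + u y *: N1 + v y *: N2)}.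
Proof.
move=> hu hv; apply: cvgD; last exact: cvgZl.
by apply: cvgD; [exact: cvg_cst|exact: cvgZl].
Qed.

End Frames.

Section Numbers.
Variable R : realType.

(** The derivatives, written in the eigenbasis, of all the maps close to the model
    satisfy these inequalities.  The entries (1,0), (2,0), (0,2) and (1,2) vanish for
    the model; the bound 2/1000 leaves room for perturbations. *)
Definition dominated_mx (C : 'M[R]_3) :=
  [/\ 223/100 <= C i0 i0,
      [/\ `|C i0 i1| <= 85/1000, `|C i0 i2| <= 2/1000, `|C i1 i0| <= 2/1000
        & `|C i2 i0| <= 2/1000],
      `|C i1 i2| <= 2/1000 /\ `|C i2 i1| <= 5/100
    & 59/100 <= `|C i1 i1| <= 102/100 /\ 55/100 <= C i2 i2 <= 57/100].

Lemma dominated_cone C : dominated_mx C -> cone_mx C.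
Proof.
move=> [h1 [h2 h3 h4 h5] [h6 h7] [/andP[h8 h9] /andP[h10 h11]]].
have h12 : `|C i2 i2| = C i2 i2 by rewrite ger0_norm//; clear -h10; lra.
split; rewrite ?h12.
- by clear -h1; lra.
- by clear -h2 h3; split; lra.
- by clear -h4 h5; split; lra.
- by clear -h6 h7 h9 h11; split; lra.
Qed.

Lemma dominated_cone_tr C : dominated_mx C -> cone_mx C^T.
Proof.
move=> [h1 [h2 h3 h4 h5] [h6 h7] [/andP[h8 h9] /andP[h10 h11]]].
have h12 : `|C i2 i2| = C i2 i2 by rewrite ger0_norm//; clear -h10; lra.
split; rewrite !mxE ?h12.
- by clear -h1; lra.
- by clear -h4 h5; split; lra.
- by clear -h2 h3; split; lra.
- by clear -h6 h7 h9 h11; split; lra.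
Qed.

(** Schur's test: a nonnegative matrix with row and column sums at most [m] has
    Euclidean operator norm at most [m]. *)
Lemma schur2 (p q r s y z m : R) : 0 <= p -> 0 <= q -> 0 <= r -> 0 <= s ->
  p + q <= m -> r + s <= m -> p + r <= m -> q + s <= m ->
  (p * y + q * z) ^+ 2 + (r * y + s * z) ^+ 2 <= m ^+ 2 * (y ^+ 2 + z ^+ 2).
Proof.
move=> p0 q0 r0 s0 h1 h2 h3 h4.
have m0 : 0 <= m by lra.
have cs u v : 0 <= u -> 0 <= v -> u + v <= m ->
    (u * y + v * z) ^+ 2 <= m * (u * y ^+ 2 + v * z ^+ 2).
  move=> u0 v0 uv.
  have k0 : 0 <= (m - (u + v)) * (u * y ^+ 2 + v * z ^+ 2).
    apply: mulr_ge0; [lra|].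
    by apply: addr_ge0; apply: mulr_ge0 => //; exact: sqr_ge0.
  have k1 : 0 <= u * v * (y - z) ^+ 2 by apply: mulr_ge0; [exact: mulr_ge0|exact: sqr_ge0].
  lra.
have e1 := cs _ _ p0 q0 h1; have e2 := cs _ _ r0 s0 h2.
have f1 : 0 <= m * ((m - (p + r)) * y ^+ 2).
  apply: mulr_ge0 => //; apply: mulr_ge0; [lra|exact: sqr_ge0].
have f2 : 0 <= m * ((m - (q + s)) * z ^+ 2).
  apply: mulr_ge0 => //; apply: mulr_ge0; [lra|exact: sqr_ge0].
lra.
Qed.

Lemma sqr_le (x y : R) : 0 <= x -> x <= y -> x ^+ 2 <= y ^+ 2.
Proof. by move=> x0 xy; rewrite lerXn2r ?nnegrE// (le_trans x0). Qed.

Lemma plane_square_sum_le (p q r s X0 X1 X2 Y0 Y1 Y2 : R) :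
  [/\ 0 <= p, 0 <= q, 0 <= r & 0 <= s] ->
  [/\ p + q <= 112/100, r + s <= 112/100, p + r <= 112/100 & q + s <= 112/100] ->
  [/\ 0 <= Y0, 0 <= Y1 & 0 <= Y2] ->
  Y0 <= 1/10 * Y1 + 1/10 * Y2 -> Y1 <= p * X1 + q * X2 -> Y2 <= r * X1 + s * X2 ->
  Y0 ^+ 2 + Y1 ^+ 2 + Y2 ^+ 2 <= (6/5) ^+ 2 * (X0 ^+ 2 + X1 ^+ 2 + X2 ^+ 2).
Proof.
move=> [p0 q0 r0 s0] [h1 h2 h3 h4] [Yp0 Yp1 Yp2] /(sqr_le Yp0) q3.
move=> /(sqr_le Yp1) q1 /(sqr_le Yp2) q2.
have S := schur2 X1 X2 p0 q0 r0 s0 h1 h2 h3 h4.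
have {S}q4 := le_trans (lerD q1 q2) S; clear q1 q2.
have q5 := sqr_ge0 X0; have q6 := sqr_ge0 X1; have q7 := sqr_ge0 X2.
have q8 : (1/10 * Y1 + 1/10 * Y2) ^+ 2 <= 2/100 * (Y1 ^+ 2 + Y2 ^+ 2).
  have := sqr_ge0 (Y1 - Y2); clear; lra.
have {q3 q8}q9 := le_trans q3 q8.
move: (X0 ^+ 2) (X1 ^+ 2) (X2 ^+ 2) (Y0 ^+ 2) (Y1 ^+ 2) (Y2 ^+ 2) q4 q5 q6 q7 q9.
clear; move=> *; lra.
Qed.

(** On a center-stable plane the first coordinate is at most a tenth of the sum of
    the others, so it perturbs the two by two block, of norm at most 11/10, only
    slightly. *)
Lemma plane_norm_le (C : 'M[R]_3) (x : 'rV[R]_3) a b a' b' : dominated_mx C ->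
  `|a| <= 1/10 -> `|b| <= 1/10 -> `|a'| <= 1/10 -> `|b'| <= 1/10 ->
  (x <= cs_frame a b)%MS -> (x *m C <= cs_frame a' b')%MS ->
  enorm (x *m C) <= 6/5 * enorm x.
Proof.
move=> dC ha hb ha' hb' /cs_frame_memP x0 /cs_frame_memP y0.
have [_ [k1 k2] _ [k3 k4]] := dominated_cone dC.
have [_ _ _ [k5 k6]] := dominated_cone_tr dC; rewrite !mxE in k5 k6.
apply: enorm_le; first lra.
have E j : (x *m C) 0 j = x 0 i0 * C i0 j + x 0 i1 * C i1 j + x 0 i2 * C i2 j.
  by rewrite mxE big_ord3.
have hx0 : `|x 0 i0| <= 1/10 * `|x 0 i1| + 1/10 * `|x 0 i2|.
  rewrite x0; apply: le_trans (ler_normB _ _) _; rewrite !normrM normrN.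
  by rewrite lerD// ler_wpM2r.
have hy0 : `|(x *m C) 0 i0| <= 1/10 * `|(x *m C) 0 i1| + 1/10 * `|(x *m C) 0 i2|.
  rewrite y0; apply: le_trans (ler_normB _ _) _; rewrite !normrM normrN.
  by rewrite lerD// ler_wpM2r.
have hy j : `|C i0 j| <= 9/100 -> `|(x *m C) 0 j| <=
    (`|C i1 j| + 9/1000) * `|x 0 i1| + (`|C i2 j| + 9/1000) * `|x 0 i2|.
  move=> hj; rewrite E; apply: le_trans (ler_normD _ _) _.
  apply: le_trans (lerD (ler_normD _ _) (lexx _)) _; rewrite !normrM.
  have := ler_pM (normr_ge0 _) (normr_ge0 _) hx0 hj; lra.
have hy1 := hy i1 k1; have hy2 := hy i2 k2.
rewrite -(real_normK (num_real ((x *m C) 0 i0))).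
rewrite -(real_normK (num_real ((x *m C) 0 i1))).
rewrite -(real_normK (num_real ((x *m C) 0 i2))).
rewrite -[x 0 i0 ^+ 2](real_normK (num_real _)).
rewrite -[x 0 i1 ^+ 2](real_normK (num_real _)).
rewrite -[x 0 i2 ^+ 2](real_normK (num_real _)).
move: hx0 hy0 hy1 hy2 => {E x0 y0 hy}.
move: (normr_ge0 (x 0 i0)) (normr_ge0 (x 0 i1)) (normr_ge0 (x 0 i2)).
move: (normr_ge0 ((x *m C) 0 i0)) (normr_ge0 ((x *m C) 0 i1)).
move: (normr_ge0 ((x *m C) 0 i2)).
move: `|_ _ i0| `|_ _ i1| `|_ _ i2| `|x _ i0| `|x _ i1| `|x _ i2| => Y0 Y1 Y2 X0 X1 X2.
move=> Y2p Y0p Y1p X0p X1p X2p hx0 hy0 hy1 hy2.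
have posD (u : R) : 0 <= `|u| + 9/1000 by apply: addr_ge0; [exact: normr_ge0|clear; lra].
have sums : [/\ (`|C i1 i1| + 9/1000) + (`|C i2 i1| + 9/1000) <= 112/100,
    (`|C i1 i2| + 9/1000) + (`|C i2 i2| + 9/1000) <= 112/100,
    (`|C i1 i1| + 9/1000) + (`|C i1 i2| + 9/1000) <= 112/100
    & (`|C i2 i1| + 9/1000) + (`|C i2 i2| + 9/1000) <= 112/100].
  by split; clear -k3 k4 k5 k6; lra.
exact: (plane_square_sum_le _ (And4 (posD _) (posD _) (posD _) (posD _)) sums
  (And3 Y0p Y1p Y2p) hy0 hy1 hy2).
Qed.

(** (109/50)^2 exceeds 4 (1 + 1/100 + 1/100). *)
Lemma graph_norm_ge (a b a' b' k t : R) :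
  `|a| <= 1/10 -> `|b| <= 1/10 -> 109/50 <= t ->
  2 * enorm (k *: graph_row a b) <= enorm (k *: (t *: graph_row a' b')).
Proof.
move=> ha hb ht.
have sq (u : R) : `|u| <= 1/10 -> u ^+ 2 <= 1/100.
  move=> hu; have := sqr_le (normr_ge0 u) hu.
  by rewrite real_normK ?num_real//; clear; lra.
have sa := sq _ ha; have sb := sq _ hb.
rewrite mulrC -ler_pdivlMr; last lra.
rewrite mulrC; apply: enorm_le; first lra.
rewrite !mxE /=.
have sa' := sqr_ge0 a'; have sb' := sqr_ge0 b'; have k2 := sqr_ge0 k.
have t2 : (109/50) ^+ 2 <= t ^+ 2 by apply: sqr_le => //; clear; lra.
rewrite !exprMn expr1n !mulr1.
have h1 : 0 <= k ^+ 2 * (t ^+ 2 - (109/50) ^+ 2) by rewrite mulr_ge0// subr_ge0.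
have h2 : 0 <= k ^+ 2 * (1/100 - a ^+ 2) by rewrite mulr_ge0// subr_ge0.
have h3 : 0 <= k ^+ 2 * (1/100 - b ^+ 2) by rewrite mulr_ge0// subr_ge0.
have h4 : 0 <= k ^+ 2 * (t ^+ 2 * a' ^+ 2) by do 2?[apply: mulr_ge0 => //]; exact: sqr_ge0.
have h5 : 0 <= k ^+ 2 * (t ^+ 2 * b' ^+ 2) by do 2?[apply: mulr_ge0 => //]; exact: sqr_ge0.
lra.
Qed.

End Numbers.

(** * Line and plane bundles in an orthonormal basis *)

Section Bundles.
Variable R : realType.
Local Notation V := 'rV[R]_3.
Local Notation T := (torus R).
Variable P : 'M[R]_3.
Hypothesis PP : P *m P^T = 1%:M.

Let PtP : P^T *m P = 1%:M. Proof. exact: mulmx1C. Qed.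

Lemma isometry_row_free : row_free P.
Proof. by apply/row_freeP; exists P^T. Qed.

(** The bundles are written in the coordinates of the orthonormal basis formed by the
    rows of [P]. *)
Definition line_bundle (a b : T -> R) p := <<graph_row (a p) (b p) *m P>>%MS.
Definition plane_bundle (c d : T -> R) p := <<cs_frame (c p) (d p) *m P>>%MS.

Lemma line_memP a b p (v : V) :
  reflect (exists k, v = k *: (graph_row (a p) (b p) *m P)) (v <= line_bundle a b p)%MS.
Proof. by rewrite genmxE; exact: sub_rVP. Qed.

Lemma plane_memE c d p (x : V) :
  (x *m P <= plane_bundle c d p)%MS = (x <= cs_frame (c p) (d p))%MS.
Proof. by rewrite genmxE submxMfree// isometry_row_free. Qed.

Lemma line_rank a b p : \rank (line_bundle a b p) = 1%N.
Proof. by rewrite genmxE mxrankMfree ?isometry_row_free// rank_graph_row. Qed.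

Lemma plane_rank c d p : \rank (plane_bundle c d p) = 2%N.
Proof. by rewrite genmxE mxrankMfree ?isometry_row_free// rank_cs_frame. Qed.

Lemma line_bundle_continuous a b : lift_continuous a -> lift_continuous b ->
  continuous_bundle (line_bundle a b).
Proof.
move=> ha hb x; exists 1%N, (fun y => graph_row (a (tproj y)) (b (tproj y)) *m P).
near=> y; split.
- have -> : (fun y : V => graph_row (a (tproj y)) (b (tproj y)) *m P) =
    (fun y => graph_row 0 0 *m P + (a \o @tproj R) y *: ((delta_mx 0 i1 : V) *m P)
       + (b \o @tproj R) y *: ((delta_mx 0 i2 : V) *m P)).
    by apply/funext => z; rewrite graph_row_affine !mulmxDl -!scalemxAl.
  by apply: continuous_affine_frame; [exact: (ha y)|exact: (hb y)].
- by rewrite /row_free mxrankMfree ?isometry_row_free// rank_graph_row.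
- by rewrite /line_bundle !genmxE !submx_refl.
Unshelve. all: by end_near. Qed.

Lemma plane_bundle_continuous c d : lift_continuous c -> lift_continuous d ->
  continuous_bundle (plane_bundle c d).
Proof.
move=> hc hd x; exists 2%N, (fun y => cs_frame (c (tproj y)) (d (tproj y)) *m P).
near=> y; split.
- have -> : (fun y : V => cs_frame (c (tproj y)) (d (tproj y)) *m P) =
    (fun y => cs_frame 0 0 *m P
       + (c \o @tproj R) y *: (- (delta_mx j0 i0 : 'M[R]_(2, 3)) *m P)
       + (d \o @tproj R) y *: (- (delta_mx j1 i0 : 'M[R]_(2, 3)) *m P)).
    apply/funext => z; rewrite cs_frame_affine !mulmxDl -!scalemxAl /=.
    by rewrite !mulNmx !scalerN !scaleNr.
  by apply: continuous_affine_frame; [exact: (hc y)|exact: (hd y)].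
- by rewrite /row_free mxrankMfree ?isometry_row_free// rank_cs_frame.
- by rewrite /plane_bundle !genmxE !submx_refl.
Unshelve. all: by end_near. Qed.

(** The quantity in the hypothesis is the pairing of the line with the conormal of
    the plane. *)
Lemma line_plane_direct a b c d p : 0 < 1 + c p * a p + d p * b p ->
  mxdirect (line_bundle a b p + plane_bundle c d p).
Proof.
move=> pos; apply/mxdirect_addsP/eqP; rewrite -submx0; apply/row_subP => i.
set v := row i _; have : (v <= line_bundle a b p :&: plane_bundle c d p)%MS by exact: row_sub.
rewrite sub_capmx => /andP[/line_memP[k ->]].
rewrite scalemxAl plane_memE => /cs_frame_memP; rewrite !mxE /= mulr1 => h.
suff -> : k = 0 by rewrite scale0r mul0mx sub0mx.
have : k * (1 + c p * a p + d p * b p) = 0 by lra.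
by move/eqP; rewrite mulf_eq0 (gt_eqF pos) orbF => /eqP.
Qed.

Lemma line_plane_full a b c d p : 0 < 1 + c p * a p + d p * b p ->
  row_full (line_bundle a b p + plane_bundle c d p).
Proof.
move=> /line_plane_direct /mxdirectP /= h.
by rewrite /row_full h line_rank plane_rank.
Qed.

Section Cocycle.
Variables (g : T -> T) (A C : T -> 'M[R]_3).
Hypothesis AE : forall p, A p = P^T *m C p *m P.
Hypothesis Aunit : forall p, A p \in unitmx.

Lemma conj_mul (x : V) p : x *m P *m A p = x *m C p *m P.
Proof. by rewrite AE !mulmxA -(mulmxA x) PP mulmx1. Qed.

Lemma line_invariant (a b t : T -> R) : (forall p, 109/50 <= t p) ->
  (forall p, graph_row (a p) (b p) *m C p = t p *: graph_row (a (g p)) (b (g p))) ->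
  forall p, (line_bundle a b p *m A p == line_bundle a b (g p))%MS.
Proof.
move=> ht h p.
have t0 : t p != 0 by rewrite gt_eqF//; have := ht p; lra.
have e : graph_row (a p) (b p) *m P *m A p
    = t p *: (graph_row (a (g p)) (b (g p)) *m P).
  by rewrite conj_mul h scalemxAl.
have E : (line_bundle a b p *m A p :=: line_bundle a b (g p))%MS.
  apply: eqmx_trans (eqmxMr _ (genmxE _)) _; rewrite e.
  exact: eqmx_trans (eqmx_scale _ t0) (eqmx_sym (genmxE _)).
by rewrite !E !submx_refl.
Qed.

(** The transposed cocycle transports conormals backwards, so it preserves
    orthogonality to them. *)
Lemma plane_sub (c d t : T -> R) :
  (forall p, graph_row (c (g p)) (d (g p)) *m (C p)^T = t p *: graph_row (c p) (d p)) ->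
  forall p (x : V), (x <= cs_frame (c p) (d p))%MS ->
    (x *m C p <= cs_frame (c (g p)) (d (g p)))%MS.
Proof.
move=> h p x /cs_frame_orthoP x0; apply/cs_frame_orthoP.
have := congr1 trmx (h p); rewrite trmx_mul trmxK linearZ /= => e.
by rewrite -mulmxA e -scalemxAr x0 scaler0.
Qed.

Lemma plane_invariant (c d t : T -> R) :
  (forall p, graph_row (c (g p)) (d (g p)) *m (C p)^T = t p *: graph_row (c p) (d p)) ->
  forall p, (plane_bundle c d p *m A p == plane_bundle c d (g p))%MS.
Proof.
move=> h p.
have s : (plane_bundle c d p *m A p <= plane_bundle c d (g p))%MS.
  rewrite (eqmxMr _ (genmxE _)); apply/row_subP => i.
  rewrite row_mul row_mul conj_mul plane_memE; apply: (plane_sub h).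
  exact: row_sub.
rewrite s /=.
rewrite -(mxrank_leqif_sup s).
by rewrite mxrankMfree ?row_free_unit// !plane_rank.
Qed.

End Cocycle.
End Bundles.

(** * Areas of planes that contain the strong unstable line *)

Section Volume.
Variable R : realType.
Local Notation V := 'rV[R]_3.

Lemma det_mx2 (M : 'M[R]_2) : \det M = M j0 j0 * M j1 j1 - M j0 j1 * M j1 j0.
Proof.
rewrite (expand_det_row _ j0) big_ord2 /cofactor !det_mx11 !mxE /=.
rewrite expr0 expr1 mul1r mulN1r mulrN.
by congr (_ * M _ _ - _ * M _ _); exact: val_inj.
Qed.

(** The squared area of the parallelogram spanned by two rows. *)
Definition gram2 (v w : V) : R :=
  (v 0 i0 ^+ 2 + v 0 i1 ^+ 2 + v 0 i2 ^+ 2) * (w 0 i0 ^+ 2 + w 0 i1 ^+ 2 + w 0 i2 ^+ 2)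
  - (v 0 i0 * w 0 i0 + v 0 i1 * w 0 i1 + v 0 i2 * w 0 i2) ^+ 2.

Lemma det_gram2 (N : 'M[R]_(2, 3)) :
  \det (N *m N^T) = gram2 (row j0 N) (row j1 N).
Proof. by rewrite det_mx2 /gram2 !mxE !big_ord3 !mxE; ring. Qed.

(** The off-diagonal coefficient of the quadratic form in the right-hand side is too
    small to spoil the diagonal ones. *)
Lemma quadratic_ge (p q r s y z : R) :
  34/100 <= p ^+ 2 -> 30/100 <= s ^+ 2 -> `|p * q + r * s| <= 55/1000 ->
  24/100 * (y ^+ 2 + z ^+ 2) <= (p * y + q * z) ^+ 2 + (r * y + s * z) ^+ 2.
Proof.
move=> hp hs; set k := p * q + r * s => hk.
have E : (p * y + q * z) ^+ 2 + (r * y + s * z) ^+ 2 =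
  p ^+ 2 * y ^+ 2 + s ^+ 2 * z ^+ 2 + (r * y) ^+ 2 + (q * z) ^+ 2 + 2 * (k * (y * z)).
  by rewrite /k; ring.
rewrite E; clearbody k.
have hyz : `|y * z| <= (y ^+ 2 + z ^+ 2) / 2.
  rewrite ler_norml; apply/andP; split.
    have := sqr_ge0 (y + z); lra.
  have := sqr_ge0 (y - z); lra.
have := ler_norm_mul hk hyz; rewrite ler_norml => /andP[h1 _].
have h2 := sqr_ge0 (r * y); have h3 := sqr_ge0 (q * z).
have h4 := ler_wpM2r (sqr_ge0 y) hp; have h5 := ler_wpM2r (sqr_ge0 z) hs.
move: {E hk hyz} (k * (y * z)) (p ^+ 2 * y ^+ 2) (s ^+ 2 * z ^+ 2) h1 h2 h3 h4 h5.
move: ((r * y) ^+ 2) ((q * z) ^+ 2) (sqr_ge0 y) (sqr_ge0 z).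
move: (y ^+ 2) (z ^+ 2); clear; move=> *; lra.
Qed.

(** By Lagrange's identity the squared area is a sum of three squares.  In the source
    plane it is at most 102/100 times the squared length of [x]; in the image the
    two squares that involve the strong unstable coordinate are at least
    (109/50)^2 * 24/100 > 102/100 times this squared length. *)
Lemma gram2_graph_lt (C : 'M[R]_3) (a b a' b' t : R) (x : V) :
  dominated_mx C ->
  `|a| <= 1/10 -> `|b| <= 1/10 -> `|a'| <= 1/10 -> `|b'| <= 1/10 ->
  109/50 <= t -> x 0 i0 = 0 -> x != 0 ->
  0 < gram2 (graph_row a b) x < gram2 (t *: graph_row a' b') (x *m C).
Proof.
move=> [h0 [h01 h02 h10 h20] [h12 h21] [/andP[h11 h11'] /andP[h22 h22']]].
move=> ha hb ha' hb' ht x0 xn0.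
pose y := x 0 i1; pose z := x 0 i2.
have yz : 0 < y ^+ 2 + z ^+ 2.
  rewrite lt_neqAle addr_ge0 ?sqr_ge0// andbT eq_sym paddr_eq0 ?sqr_ge0//.
  rewrite !sqrf_eq0; apply: contra xn0 => /andP[/eqP y0 /eqP z0].
  by apply/eqP/rowP => j; rewrite mxE; case: (ord3P j) => ->.
have E0 : gram2 (graph_row a b) x = y ^+ 2 + z ^+ 2 + (a * z - b * y) ^+ 2.
  by rewrite /gram2 !mxE /= x0 -/y -/z; ring.
have E1 : gram2 (t *: graph_row a' b') (x *m C) = t ^+ 2 *
   ((a' * (x *m C) 0 i2 - b' * (x *m C) 0 i1) ^+ 2 +
    (((C i1 i1 - a' * C i1 i0) * y + (C i2 i1 - a' * C i2 i0) * z) ^+ 2 +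
     ((C i1 i2 - b' * C i1 i0) * y + (C i2 i2 - b' * C i2 i0) * z) ^+ 2)).
  have gE j : (t *: graph_row a' b') 0 j = t * [:: 1; a'; b']`_j by rewrite !mxE.
  have xE j : (x *m C) 0 j = y * C i1 j + z * C i2 j.
    by rewrite mxE big_ord3 x0 mul0r add0r.
  by rewrite /gram2 !gE !xE /=; ring.
have sq (u : R) : `|u| <= 1/10 -> u ^+ 2 <= 1/100.
  move=> hu; have := sqr_le (normr_ge0 u) hu.
  by rewrite real_normK ?num_real//; clear; lra.
have U0 : y ^+ 2 + z ^+ 2 + (a * z - b * y) ^+ 2 <= 102/100 * (y ^+ 2 + z ^+ 2).
  have k1 := ler_wpM2r (addr_ge0 (sqr_ge0 y) (sqr_ge0 z)) (sq _ ha).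
  have k2 := ler_wpM2r (addr_ge0 (sqr_ge0 y) (sqr_ge0 z)) (sq _ hb).
  have k3 := sqr_ge0 (a * y + b * z).
  clear -k1 k2 k3; lra.
have small (u v : R) : `|u| <= 1/10 -> `|v| <= 2/1000 -> `|u * v| <= 1/5000.
  by move=> hu hv; apply: le_trans (ler_norm_mul hu hv) _; clear; lra.
have L1 : 24/100 * (y ^+ 2 + z ^+ 2) <=
   ((C i1 i1 - a' * C i1 i0) * y + (C i2 i1 - a' * C i2 i0) * z) ^+ 2 +
   ((C i1 i2 - b' * C i1 i0) * y + (C i2 i2 - b' * C i2 i0) * z) ^+ 2.
  have s1 := small _ _ ha' h10; have s2 := small _ _ ha' h20.
  have s3 := small _ _ hb' h10; have s4 := small _ _ hb' h20.
  move: (a' * C i1 i0) (a' * C i2 i0) (b' * C i1 i0) (b' * C i2 i0) s1 s2 s3 s4.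
  move=> e1 e2 e3 e4 s1 s2 s3 s4.
  have n1 : `|C i1 i1 - e1| <= 1021/1000.
    apply: le_trans (ler_normB _ _) _; clear -h11' s1; lra.
  have n1' : 588/1000 <= `|C i1 i1 - e1|.
    have := lerB_dist (C i1 i1) e1; clear -h11 s1; lra.
  have n2 : `|C i2 i1 - e2| <= 51/1000.
    apply: le_trans (ler_normB _ _) _; clear -h21 s2; lra.
  have n3 : `|C i1 i2 - e3| <= 3/1000.
    apply: le_trans (ler_normB _ _) _; clear -h12 s3; lra.
  have n4 : 549/1000 <= C i2 i2 - e4 <= 571/1000.
    by move: s4; rewrite ler_norml => /andP[k1 k2]; clear -h22 h22' k1 k2; apply/andP; split; lra.
  have n4' : `|C i2 i2 - e4| <= 571/1000.
    case/andP: n4 => k1 k2; rewrite ger0_norm; clear -k1 k2; lra.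
  apply: quadratic_ge.
  - rewrite -(real_normK (num_real (C i1 i1 - e1))).
    have p0 : (0 : R) <= 588/1000 by clear; lra.
    by apply: le_trans (sqr_le p0 n1'); clear; lra.
  - have p0 : (0 : R) <= 549/1000 by clear; lra.
    case/andP: n4 => n4 _; apply: le_trans (sqr_le p0 n4); clear; lra.
  - apply: le_trans (ler_normD _ _) _.
    have m1 := ler_norm_mul n1 n2; have m2 := ler_norm_mul n3 n4'.
    clear -m1 m2; lra.
have t2 : 475/100 <= t ^+ 2.
  have p0 : (0 : R) <= 109/50 by clear; lra.
  by apply: le_trans (sqr_le p0 ht); clear; lra.
rewrite E0 E1; apply/andP; split.
  by apply: ltr_wpDr => //; exact: sqr_ge0.
apply: le_lt_trans U0 _.
set S := (X in t ^+ 2 * X).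
have L2 : 24/100 * (y ^+ 2 + z ^+ 2) <= S.
  apply: le_trans L1 _; rewrite /S; rewrite lerDr; exact: sqr_ge0.
have L3 : 475/100 * (24/100 * (y ^+ 2 + z ^+ 2)) <= t ^+ 2 * S.
  apply: (ler_pM _ _ t2 L2); first by clear; lra.
  by apply: mulr_ge0; [clear; lra|exact: ltW].
apply: lt_le_trans L3; move: yz; clear; move: (y ^+ 2 + z ^+ 2) => w; lra.
Qed.

(** A plane containing [w] has a basis formed by [w] and a row without component
    along the first basis vector.  The change of basis has determinant equal to the
    first coordinate of [w], which is 1, so it preserves areas exactly. *)
Lemma row_decomposition (P : 'M[R]_3) (B : 'M[R]_(2, 3)) (w : V) :
  P *m P^T = 1%:M -> row_free B -> (w <= B)%MS -> (w *m P^T) 0 i0 = 1 ->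
  exists (x : V) (D : 'M[R]_2), [/\ \det D = 1, row j0 (D *m B) = w,
    row j1 (D *m B) = x *m P, x 0 i0 = 0 & x != 0].
Proof.
move=> PP Bf /submxP[D1 wE] w0.
pose m j := (B *m P^T) j i0.
(* The second row cancels the first coordinates [m j0] and [m j1] of the rows of [B]. *)
pose D : 'M[R]_2 := \matrix_(i, j)
  (nth [::] [:: [:: D1 0 j0; D1 0 j1]; [:: - m j1; m j0]] i)`_j.
have dD : \det D = 1.
  rewrite det_mx2 !mxE /= -w0 wE -mulmxA mxE big_ord2 /m; ring.
have r0 : row j0 (D *m B) = w.
  rewrite wE row_mul; congr (_ *m _); apply/rowP => j; rewrite !mxE /=.
  by case: j => -[|[|//]] hj /=; congr (D1 _ _); exact: val_inj.
exists (row j1 (D *m B) *m P^T), D; split=> //.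
- by rewrite -mulmxA (mulmx1C PP) mulmx1.
- rewrite row_mul -mulmxA mxE big_ord2 -/(m j0) -/(m j1) !mxE /=; ring.
- apply/eqP => h.
  have h1 : row j1 (D *m B) = 0.
    by rewrite -[LHS]mulmx1 -(mulmx1C PP) mulmxA h mul0mx.
  have Du : D \in unitmx by rewrite unitmxE dD unitr1.
  have : row j1 D *m B = 0 by rewrite -row_mul.
  move/eqP; rewrite mulmx_free_eq0// => /eqP h2.
  have : row j1 D = 0 by [].
  move: dD; rewrite (expand_det_row _ j1) big1 => [/eqP|i _].
    by rewrite eq_sym oner_eq0.
  by have := congr1 (fun v : 'rV_2 => v 0 i) h2; rewrite !mxE => ->; rewrite mul0r.
Qed.

Lemma gram_det_change (D : 'M[R]_2) (N : 'M[R]_(2, 3)) : \det D = 1 ->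
  \det (D *m N *m (D *m N)^T) = \det (N *m N^T).
Proof.
by move=> h; rewrite trmx_mul !mulmxA -(mulmxA D) !det_mulmx det_tr h mul1r mulr1.
Qed.

Lemma jac_on_gt1 (P C A H : 'M[R]_3) (a b a' b' t : R) :
  P *m P^T = 1%:M -> A = P^T *m C *m P -> dominated_mx C ->
  `|a| <= 1/10 -> `|b| <= 1/10 -> `|a'| <= 1/10 -> `|b'| <= 1/10 ->
  109/50 <= t -> graph_row a b *m C = t *: graph_row a' b' ->
  \rank H = 2%N -> (graph_row a b *m P <= H)%MS -> 1 < jac_on A H.
Proof.
move=> PP AE dC ha hb ha' hb' ht hg rH.
rewrite -(eq_row_base H) /jac_on.
have := row_base_free H; move: (row_base H); rewrite rH => B Bf wB.
have [|x [D [dD r0 r1 x0 xn]]] := row_decomposition PP Bf wB.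
  by rewrite -mulmxA PP mulmx1 mxE.
have [G0 G1] := andP (gram2_graph_lt dC ha hb ha' hb' ht x0 xn).
have gP (v w : V) : gram2 (v *m P) (w *m P) = gram2 v w.
  pose N : 'M[R]_(2, 3) := \matrix_(i < 2) (if i == j0 then v else w).
  have := det_gram2 (N *m P); rewrite trmx_mul mulmxA -(mulmxA N) PP mulmx1 det_gram2.
  by rewrite !row_mul !rowK /= => ->.
have E0 : \det (B *m B^T) = gram2 (graph_row a b) x.
  by rewrite -(gram_det_change _ dD) det_gram2 r0 r1 gP.
have E1 : \det (B *m A *m (B *m A)^T) = gram2 (t *: graph_row a' b') (x *m C).
  rewrite -(gram_det_change _ dD) det_gram2 mulmxA !(row_mul _ _ A) r0 r1 AE.
  by rewrite !mulmxA -!(mulmxA _ P) PP !mulmx1 hg gP.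
rewrite /gram_volume E0 E1 ltr_pdivlMr ?sqrtr_gt0// mul1r ltr_sqrt//.
exact: lt_trans G1.
Qed.

End Volume.

(** * Robust partially hyperbolic splittings *)

Section Splitting.
Variable R : realType.
Local Notation V := 'rV[R]_3.
Local Notation T := (torus R).
Variables (g : T -> T) (P : 'M[R]_3) (C : T -> 'M[R]_3).
Hypothesis tg : has_tangents g.
Hypothesis gu : forall p, tangent g p \in unitmx.
Hypothesis PP : P *m P^T = 1%:M.
Hypothesis CE : forall p, tangent g p = P^T *m C p *m P.
Hypothesis dC : forall p, dominated_mx (C p).
Variables a b t c d t' : T -> R.
Hypothesis ca : lift_continuous a.
Hypothesis cb : lift_continuous b.
Hypothesis cc : lift_continuous c.
Hypothesis cd : lift_continuous d.
Hypothesis ab_le : forall p, `|a p| <= 1/10 /\ `|b p| <= 1/10.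
Hypothesis cd_le : forall p, `|c p| <= 1/10 /\ `|d p| <= 1/10.
Hypothesis t_ge : forall p, 109/50 <= t p.
Hypothesis abE : forall p,
  graph_row (a p) (b p) *m C p = t p *: graph_row (a (g p)) (b (g p)).
Hypothesis cdE : forall p,
  graph_row (c (g p)) (d (g p)) *m (C p)^T = t' p *: graph_row (c p) (d p).

Let Eu := line_bundle P a b.
Let Ecs := plane_bundle P c d.

Lemma line_one_step p (v : V) : (v <= Eu p)%MS ->
  2 * enorm v <= enorm (v *m tangent g p).
Proof.
move=> /line_memP[k ->]; rewrite CE.
have -> : k *: (graph_row (a p) (b p) *m P) *m (P^T *m C p *m P) =
    k *: (t p *: graph_row (a (g p)) (b (g p))) *m P.
  rewrite -!scalemxAl; congr (k *: _).
  by rewrite !mulmxA -(mulmxA _ P) PP mulmx1 abE -scalemxAl.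
rewrite scalemxAl !enorm_isometry//.
by have [ha hb] := ab_le p; exact: graph_norm_ge.
Qed.

Lemma plane_one_step p (v : V) : (v <= Ecs p)%MS ->
  enorm (v *m tangent g p) <= 6/5 * enorm v.
Proof.
move=> hv; have vE : v = v *m P^T *m P by rewrite -mulmxA (mulmx1C PP) mulmx1.
move: hv; rewrite {}vE; set x := v *m P^T; rewrite plane_memE// => hx.
have -> : x *m P *m tangent g p = x *m C p *m P.
  by rewrite CE !mulmxA -(mulmxA x) PP mulmx1.
rewrite !(enorm_isometry _ PP).
have [hc hd] := cd_le p; have [hc' hd'] := cd_le (g p).
exact: (plane_norm_le (dC p) hc hd hc' hd' hx (plane_sub cdE hx)).
Qed.

Lemma splitting_transverse p : 0 < 1 + c p * a p + d p * b p.
Proof.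
have [h1 h2] := ab_le p; have [h3 h4] := cd_le p.
have := ler_norm_mul h3 h1; have := ler_norm_mul h4 h2.
by rewrite !ler_norml => /andP[+ _] /andP[+ _]; lra.
Qed.

Lemma rank1_neq0 (E : T -> 'M[R]_3) n p : \rank (E p) = n.+1 -> E p != 0.
Proof. by move=> h; rewrite -mxrank_eq0 h. Qed.

(** The factor 2 on the lines against 6/5 on the planes gives domination with ratio
    5/3, and both uniform estimates with the constant 1. *)
Lemma sections_ph_splitting : ph_splitting g Eu Ecs.
Proof.
split.
- by split; [exact: line_bundle_continuous|exact: plane_bundle_continuous].
- by split=> p; [exact: (line_invariant PP CE t_ge abE)
    |exact: (plane_invariant PP CE gu cdE)].
- by move=> p; split; [apply: rank1_neq0 (line_rank PP a b p)
    |apply: rank1_neq0 (plane_rank PP c d p)].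
- move=> p; have pos := splitting_transverse p.
  by split; [exact: line_plane_direct|exact: line_plane_full].
have invu p (v : V) : (v <= Eu p)%MS -> (v *m tangent g p <= Eu (g p))%MS.
  move=> hv; apply: submx_trans (submxMr _ hv) _.
  by case/andP: (line_invariant PP CE t_ge abE p).
have invc p (v : V) : (v <= Ecs p)%MS -> (v *m tangent g p <= Ecs (g p))%MS.
  move=> hv; apply: submx_trans (submxMr _ hv) _.
  by case/andP: (plane_invariant PP CE gu cdE p).
have two0 : (0 : R) <= 2 by lra.
have six0 : (0 : R) <= 6/5 by lra.
have eu := iter_expansion tg invu two0 line_one_step.
have ec := iter_contraction tg invc six0 plane_one_step.
exists 1, (5/3); split; [by []|by lra| |].
- move=> n p v _ hv; rewrite mul1r.
  apply: le_trans (eu n p v hv); apply: ler_wpM2r; first exact: enorm_ge0.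
  by rewrite lerXn2r ?nnegrE//; lra.
- move=> n p v1 v2 _ hv1 hv2 n1 n2; rewrite mul1r.
  have h1 := eu n p v1 hv1; have h2 := ec n p v2 hv2.
  rewrite n1 mulr1 in h1; rewrite n2 mulr1 in h2.
  have pos : 0 < enorm (v2 *m tangent (iter n g) p).
    rewrite enorm_gt0; apply/eqP => h0.
    have un := tangent_iter_unit tg n p gu.
    move: n2; rewrite -(mulmxK un v2) h0 mul0mx /enorm big1 ?sqrtr0 => [/eqP|i _].
      by rewrite eq_sym oner_eq0.
    by rewrite mxE expr0n.
  rewrite ler_pdivlMr//; apply: le_trans h1.
  have -> : 2 ^+ n = (5/3) ^+ n * (6/5) ^+ n :> R.
    by rewrite -exprMn; congr (_ ^+ n); field.
  by apply: ler_wpM2l => //; apply: exprn_ge0; lra.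
Qed.

Lemma sections_volume_expanding : volume_expanding_along g Eu.
Proof.
move=> p H rH hH; have [ha hb] := ab_le p; have [ha' hb'] := ab_le (g p).
apply: (@jac_on_gt1 _ P (C p) _ _ (a p) (b p) (a (g p)) (b (g p)) (t p)) => //.
by move: hH; rewrite genmxE.
Qed.

End Splitting.

Section Robustness.
Variable R : realType.
Local Notation V := 'rV[R]_3.
Local Notation T := (torus R).

(** The chain rule for the inverse diffeomorphism. *)
Lemma diffeo_tangent_unit (g : T -> T) p : Ck_diffeo 1 g -> tangent g p \in unitmx.
Proof.
move=> [hg [h [gK _ hh]]].
have e := C1_tangent_comp p hg hh.
have hgid : h \o g = id by apply/funext => q; exact: gK.
have {}e : tangent g p *m tangent h (g p) = 1%:M.
  by apply: (etrans (esym e)); rewrite hgid; exact: tangent_id.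
by have [u _] := mulmx1_unit e; exact: u.
Qed.

Lemma lift_continuous_conj (P Q : 'M[R]_3) (A : T -> 'M[R]_3) i j :
  (forall i j, lift_continuous (fun p => A p i j)) ->
  lift_continuous (fun p => (P *m A p *m Q) i j).
Proof.
move=> cA.
have -> : (fun p => (P *m A p *m Q) i j) =
    (fun p => \sum_l (\sum_k P i k * A p k l) * Q l j).
  by apply/funext => p; rewrite mxE; apply: eq_bigr => l _; rewrite mxE.
have c1 l : lift_continuous (fun p => \sum_k P i k * A p k l).
  have -> : (fun p => \sum_k P i k * A p k l) = (fun p =>
     P i i0 * A p i0 l + P i i1 * A p i1 l + P i i2 * A p i2 l).
    by apply/funext => p; rewrite big_ord3.
  by do 2?apply: lift_continuousD; apply: lift_continuousM;
    try exact: lift_continuous_cst; exact: cA.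
have -> : (fun p => \sum_l (\sum_k P i k * A p k l) * Q l j) = (fun p =>
   (\sum_k P i k * A p k i0) * Q i0 j + (\sum_k P i k * A p k i1) * Q i1 j
   + (\sum_k P i k * A p k i2) * Q i2 j).
  by apply/funext => p; rewrite big_ord3.
by do 2?apply: lift_continuousD; apply: lift_continuousM;
  try exact: lift_continuous_cst; exact: c1.
Qed.

(** The line field is pushed forward, hence the contraction acts along the inverse of
    the dynamics. *)
Lemma dominated_sections (g : T -> T) (C : T -> 'M[R]_3) : Ck_diffeo 1 g ->
  (forall i j, lift_continuous (fun p => C p i j)) ->
  (forall p, dominated_mx (C p)) ->
  exists a b t : T -> R, [/\ lift_continuous a, lift_continuous b,
    forall p, `|a p| <= 1/10 /\ `|b p| <= 1/10, forall p, 109/50 <= t p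
    & forall p, graph_row (a p) (b p) *m C p = t p *: graph_row (a (g p)) (b (g p))].
Proof.
move=> [hg [h [gK hK hh]]] cC dC.
have cont_h (u : T -> R) : lift_continuous u -> lift_continuous (u \o h).
  by move=> hu; apply: C1_lift_continuous_comp hu; exact: torus_C1_C0.
have [||a [b [t [ca cb ab_le t_ge abE]]]] := @cone_section R h (C \o h) cont_h.
- by move=> p; exact: (dominated_cone (dC (h p))).
- by move=> i j; exact: (cont_h (fun p => C p i j) (cC i j)).
exists a, b, (t \o g); split=> // p; first exact: t_ge.
by have := abE (g p); rewrite /= gK.
Qed.

(** The pointwise criterion from which both the expansion of the model and its
    robustness follow.  Since the basis [P] does not depend on the point, the
    derivatives of two maps can be compared at each point as matrices. *)
Theorem dominated_partially_volume_expanding (g : T -> T) (P : 'M[R]_3) :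
  P *m P^T = 1%:M -> Ck_diffeo 1 g ->
  (forall p, dominated_mx (P *m tangent g p *m P^T)) ->
  partially_volume_expanding g.
Proof.
move=> PP dg dC.
pose C p := P *m tangent g p *m P^T.
have [hg _] := dg.
have CE p : tangent g p = P^T *m C p *m P.
  by rewrite /C !mulmxA (mulmx1C PP) mul1mx -mulmxA (mulmx1C PP) mulmx1.
have cC i j : lift_continuous (fun p => C p i j).
  by apply: lift_continuous_conj => k l; exact: C1_tangent_entry_continuous.
have [a [b [t [ca cb ab_le t_ge abE]]]] := dominated_sections dg cC dC.
have cont_g (u : T -> R) : lift_continuous u -> lift_continuous (u \o g).
  by move=> hu; apply: C1_lift_continuous_comp hu; exact: torus_C1_C0.
have [||c [d [t' [cc cd cd_le _ cdE]]]] := @cone_section R g (fun p => (C p)^T) cont_g.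
- by move=> p; exact: (dominated_cone_tr (dC p)).
- by move=> i j; have -> : (fun p => (C p)^T i j) = (fun p => C p j i);
    [apply/funext => p; rewrite mxE|exact: cC].
exists (line_bundle P a b), (plane_bundle P c d); split.
- apply: (@sections_ph_splitting R g P C _ _ PP CE dC a b t c d t') => //.
  + by move=> x; exact: C1_is_tangent.
  + by move=> p; exact: diffeo_tangent_unit.
- exact: (@sections_volume_expanding R g P C PP CE dC a b t).
Qed.

End Robustness.

(** * Smooth waves and the inverse of the phase map *)

Section Waves.
Variable R : realType.
Local Notation V := 'rV[R]_3.
Implicit Types (b w x v : V) (N : 'M[R]_3) (l : 'cV[R]_3) (u : R -> R).

Lemma differentiable_mulrow n (N : 'M[R]_(3, n)) (x : V) :
  differentiable (fun y : V => y *m N) x.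
Proof.
have -> : (fun y : V => y *m N) = (fun y => \sum_i y 0 i *: row i N).
  by apply/funext => y; rewrite mulmx_sum_row.
have -> : (fun y : V => \sum_i y 0 i *: row i N) =
    \sum_i ((fun y : V => y 0 i *: row i N)).
  by apply/funext => y; rewrite fct_sumE.
apply: differentiable_sum => i; apply: differentiableZl.
exact: differentiable_coord.
Qed.

Lemma continuous_mulrow n (N : 'M[R]_(3, n)) : continuous (fun y : V => y *m N).
Proof. by move=> x; apply: differentiable_continuous; exact: differentiable_mulrow. Qed.

Lemma diff_mulrow n (N : 'M[R]_(3, n)) (x v : V) :
  'd (fun y : V => y *m N) x v = v *m N.
Proof.
by rewrite (@diff_lin R V 'rV[R]_n (mulmxr N) x (@continuous_mulrow n N)).
Qed.

(** An affine map plus a scalar function of one linear coordinate; the derivatives of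
    such maps in a fixed direction have the same shape, with the derivative of the
    scalar function. *)
Definition wave (b : V) (N : 'M[R]_3) (l : 'cV[R]_3) (u : R -> R) (w : V) (x : V) : V :=
  b + x *m N + u ((x *m l) 0 0) *: w.

Lemma differentiable_phase (l : 'cV[R]_3) (x : V) :
  differentiable (fun y : V => (y *m l) 0 0) x.
Proof.
apply: (@differentiable_comp _ _ _ _ (fun y : V => y *m l) (fun M : 'rV_1 => M 0 0)).
  exact: differentiable_mulrow.
exact: differentiable_coord.
Qed.

Lemma differentiable_wave b N l u (u' : R -> R) w x :
  (forall t : R, is_derive t (1 : R) u (u' t)) ->
  differentiable (wave b N l u w) x.
Proof.
move=> du; apply: differentiableD.
  apply: differentiableD; first exact: differentiable_cst.
  exact: differentiable_mulrow.
apply: differentiableZl.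
apply: (@differentiable_comp _ _ _ _ (fun y : V => (y *m l) 0 0) u).
  exact: differentiable_phase.
by apply/derivable1_diffP; case: (du ((x *m l) 0 0)).
Qed.

Lemma derive_wave b N l u (u' : R -> R) w v x : (forall t : R, is_derive t (1 : R) u (u' t)) ->
  'D_v (wave b N l u w) x = wave (v *m N) 0 l u' ((v *m l) 0 0 *: w) x.
Proof.
move=> du.
have dphase := differentiable_phase l x.
have du1 : differentiable u ((x *m l) 0 0).
  by apply/derivable1_diffP; case: (du ((x *m l) 0 0)).
have dul : differentiable (fun y : V => u ((y *m l) 0 0)) x.
  exact: (differentiable_comp dphase du1).
have d1 : is_derive x v (fun y : V => b + y *m N) (v *m N).
  have h : is_derive x v (fun y : V => y *m N) (v *m N).
    apply: DeriveDef; first exact/diff_derivable/differentiable_mulrow.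
    by rewrite deriveE ?diff_mulrow//; exact: differentiable_mulrow.
  by have := is_deriveD (is_derive_cst b x v) h; rewrite add0r.
have dphaseE : 'd (fun y : V => (y *m l) 0 0) x v = (v *m l) 0 0.
  rewrite -deriveE//.
  have dl : differentiable (fun y : V => y *m l) x by exact: differentiable_mulrow.
  have := derive_mx (diff_derivable (v := v) dl).
  move=> /(congr1 (fun M : 'M[R]_(1, 1) => M 0 0)); rewrite mxE => e.
  by apply: (etrans (esym e)); rewrite deriveE// diff_mulrow.
have d2 : is_derive x v (fun y : V => u ((y *m l) 0 0) *: w)
    ((u' ((x *m l) 0 0) * (v *m l) 0 0) *: w).
  apply: DeriveDef; first exact/diff_derivable/differentiableZl.
  rewrite deriveE; last exact: differentiableZl.
  rewrite diffZl//=; congr (_ *: w).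
  have := congr1 (fun L : V -> R => L v) (diff_comp dphase du1).
  move=> /= e; apply: (etrans e); rewrite dphaseE.
  have [du2 du3] := du ((x *m l) 0 0).
  have := congr1 (fun L : R -> R => L ((v *m l) 0 0)) (deriv1E du2).
  move=> /= e'; apply: (etrans e'); rewrite derive1E du3.
  by rewrite mulrC.
have [_ ->] := is_deriveD d1 d2.
by rewrite /wave mulmx0 addr0 scalerA mulrC.
Qed.

(** A set of functions closed under differentiation consists of smooth ones; this
    replaces reasoning on iterated derivatives. *)
Definition derivative_closed (S : set (R -> R)) :=
  forall u, S u -> exists2 u', S u' & forall t : R, is_derive t (1 : R) u (u' t).

Lemma Ck_wave (S : set (R -> R)) k b N l u w : derivative_closed S -> S u ->
  Ck_on k setT (wave b N l u w).
Proof.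
move=> hS; elim: k b N u w => [|k IH] b N u w Su; have [u' Su' du] := hS u Su.
  by move=> x _; apply: differentiable_continuous; exact: differentiable_wave.
split=> [x _|v]; first exact: differentiable_wave.
have -> : 'D_v (wave b N l u w) = wave (v *m N) 0 l u' ((v *m l) 0 0 *: w).
  by apply/funext => x; exact: derive_wave.
exact: IH.
Qed.

End Waves.

Section Phase.
Variable R : realType.
Variable delta : R.
Hypothesis delta_small : `|delta| <= 1/2.

Local Notation tau := (2 * pi : R).

(** Up to the linear automorphism, the perturbed map acts by this scalar map on the
    coordinate along the wave covector. *)
Definition phase (th : R) : R := th + delta / tau * sin (tau * th).

Definition phase_slope (th : R) : R := 1 + delta * cos (tau * th).

Lemma phase_slope_ge th : 1/2 <= phase_slope th.
Proof.
have : `|delta * cos (tau * th)| <= 1/2 * 1.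
  by apply: ler_norm_mul => //; rewrite ler_norml cos_geN1 cos_le1.
by rewrite ler_norml /phase_slope => /andP[+ _]; lra.
Qed.

Lemma is_derive_scale (k t : R) : is_derive t (1 : R) (fun x : R => k * x) k.
Proof.
have := is_deriveZ k (is_derive_id t (1 : R)).
by move=> /is_derive_eq; apply; rewrite /GRing.scale /= mulr1.
Qed.

Lemma is_derive_phase (th : R) : is_derive th (1 : R) phase (phase_slope th).
Proof.
have h1 := is_derive_scale tau th.
have h2 := is_derive1_comp (is_derive_sin (tau * th)) h1.
have h3 := is_deriveD (is_derive_id th (1 : R)) (is_deriveZ (delta / tau) h2).
apply: (is_derive_eq h3); rewrite /phase_slope /GRing.scale /=.
have p0 : (pi : R) != 0 by rewrite gt_eqF ?pi_gt0.
congr (_ + _); move: (pi : R) p0 (cos _) => p p0 q; by field.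
Qed.

Lemma phase_continuous : continuous phase.
Proof.
move=> t; apply: differentiable_continuous; apply/derivable1_diffP.
by case: (is_derive_phase t).
Qed.

Lemma phase_lt x y : x < y -> phase x < phase y.
Proof.
move=> xy; apply: (@gtr0_derive1_incr R phase x y) => //.
- move=> z _; rewrite derive1E; case: (is_derive_phase z) => _ ->.
  by apply: lt_le_trans (phase_slope_ge z); lra.
- by apply: continuous_subspaceT; exact: phase_continuous.
Qed.

Lemma phase_inj : injective phase.
Proof.
by move=> x y e; case: (ltgtP x y) => // /phase_lt; rewrite e ltxx.
Qed.

(** The intermediate value theorem, as [phase] is at bounded distance from the
    identity. *)
Lemma phase_surj t : exists th, phase th = t.
Proof.
pose B := `|delta / tau|.
have hB x : `|phase x - x| <= B.
  rewrite /phase addrC addKr normrM ler_piMr//.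
  by rewrite ler_norml sin_geN1 sin_le1.
have B0 : 0 <= B by exact: normr_ge0.
have [c _ <-] : exists2 c, c \in `[t - B, t + B] & phase c = t; last by exists c.
apply: IVT.
- by lra.
- by apply: continuous_subspaceT; exact: phase_continuous.
- have := hB (t - B); have := hB (t + B); rewrite !ler_norml.
  move=> /andP[h1 h2] /andP[h3 h4].
  by rewrite ge_min le_max; apply/andP; split; apply/orP; [left|right]; lra.
Qed.

Definition phase_inv (t : R) : R := xget 0 [set th | phase th = t].

Lemma phase_invK : cancel phase_inv phase.
Proof.
move=> t; have [th e] := phase_surj t.
by rewrite /phase_inv; case: xgetP => [y _ //|/(_ th)/(_ e)].
Qed.

Lemma phaseK : cancel phase phase_inv.
Proof. by move=> th; apply: phase_inj; rewrite phase_invK. Qed.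

Lemma is_derive_phase_inv (t : R) : is_derive t (1 : R) phase_inv (phase_slope (phase_inv t))^-1.
Proof.
rewrite -{1}(phase_invK t); apply: is_derive_inverse.
- by near=> x; exact: phaseK.
- by near=> x; exact: phase_continuous.
- exact: is_derive_phase.
- by rewrite gt_eqF//; apply: lt_le_trans (phase_slope_ge _); lra.
Unshelve. all: by end_near. Qed.

(** The algebra generated by the sine and the cosine of the inverse phase, and by the
    reciprocal of the slope: differentiation maps each generator to a polynomial in
    the generators. *)
Inductive phase_algebra : set (R -> R) :=
| PAcst k : phase_algebra (cst k)
| PAsin : phase_algebra (fun t => sin (tau * phase_inv t))
| PAcos : phase_algebra (fun t => cos (tau * phase_inv t))
| PAslope : phase_algebra (fun t => (phase_slope (phase_inv t))^-1)
| PAadd u v : phase_algebra u -> phase_algebra v -> phase_algebra (u + v)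
| PAmul u v : phase_algebra u -> phase_algebra v -> phase_algebra (u * v).

Lemma phase_algebra_closed : derivative_closed phase_algebra.
Proof.
pose H := fun t : R => tau * phase_inv t.
have dH (t : R) : is_derive t (1 : R) H (tau * (phase_slope (phase_inv t))^-1).
  exact: is_derive1_comp (is_derive_scale tau _) (is_derive_phase_inv t).
have dS (t : R) := @is_derive1_comp R (@sin R) H t _ _ (is_derive_sin (H t)) (dH t).
have dC (t : R) := @is_derive1_comp R (@cos R) H t _ _ (is_derive_cos (H t)) (dH t).
move=> u; elim=> {u} [k| | | |u v _ [u' hu' du] _ [v' hv' dv]|u v hu [u' hu' du] hv [v' hv' dv]].
- by exists (cst 0); [exact: PAcst|move=> t; exact: is_derive_cst].
- exists ((fun t => cos (tau * phase_inv t)) *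
    (cst tau * (fun t => (phase_slope (phase_inv t))^-1))).
    exact: PAmul PAcos (PAmul (PAcst _) PAslope).
  by move=> t; exact: dS.
- exists (cst (-1) * (fun t => sin (tau * phase_inv t)) *
    (cst tau * (fun t => (phase_slope (phase_inv t))^-1))).
    exact: PAmul (PAmul (PAcst _) PAsin) (PAmul (PAcst _) PAslope).
  by move=> t; apply: (is_derive_eq (dC t)); rewrite /= !fctE /=; ring.
- pose c : R -> R := fun t => cos (tau * phase_inv t).
  pose s : R -> R := fun t => sin (tau * phase_inv t).
  pose D : R -> R := fun t => (phase_slope (phase_inv t))^-1.
  exists (cst (tau * delta) * s * D * D * D).
    exact: PAmul (PAmul (PAmul (PAmul (PAcst _) PAsin) PAslope) PAslope) PAslope.
  move=> t.
  have h1 : is_derive t (1 : R) (cst 1 + delta *: c)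
      (0 + delta *: (- sin (tau * phase_inv t) * (tau * (phase_slope (phase_inv t))^-1))).
    exact: is_deriveD (is_derive_cst _ _ _) (is_deriveZ _ (dC t)).
  have h2 : (cst 1 + delta *: c) t != 0.
    by rewrite gt_eqF//; apply: lt_le_trans (phase_slope_ge (phase_inv t)); lra.
  have h3 := is_deriveV h2 h1.
  apply: (is_derive_eq h3); rewrite /= /GRing.scale /= -[(cst 1 + _) t]/(phase_slope (phase_inv t)).
  rewrite !fctE /s /D /=.
  have h4 : phase_slope (phase_inv t) != 0 by exact: h2.
  by field.
- exists (u' + v'); first exact: PAadd.
  by move=> t; exact: is_deriveD.
- exists (u * v' + v * u'); first by apply: PAadd; apply: PAmul.
  by move=> t; exact: is_deriveM.
Qed.

End Phase.

(** * The hyperbolic integer matrix and its eigenbasis *)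

(** Its characteristic polynomial is X^3 - 2 X^2 - X + 1, whose roots generate the
    real subfield of the seventh cyclotomic field. *)
Definition hyp_matZ : 'M[int]_3 := \matrix_(i, j)
  (nth [::] [:: [:: 1; 1; 1]; [:: 1; 1; 0]; [:: 1; 0; 0]] i)`_j.
Definition hyp_matZ_inv : 'M[int]_3 := \matrix_(i, j)
  (nth [::] [:: [:: 0; 0; 1]; [:: 0; 1; -1]; [:: 1; -1; 0]] i)`_j.
(** An integer covector close to the direction of the center eigenvector, which is
    proportional to (1, -0.555, -1.247). *)
Definition phase_covecZ : 'cV[int]_3 := \col_i [:: 1; 0; -1]`_i.

Lemma hyp_matZ_mulV : hyp_matZ *m hyp_matZ_inv = 1%:M.
Proof.
apply/matrixP => i j; rewrite !mxE big_ord3 !mxE.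
by case: (ord3P i) => ->; case: (ord3P j) => ->.
Qed.

Lemma hyp_matZ_Vmul : hyp_matZ_inv *m hyp_matZ = 1%:M.
Proof. exact: mulmx1C hyp_matZ_mulV. Qed.

Section Eigenbasis.
Variable R : realType.
Local Notation V := 'rV[R]_3.

Definition hyp_mat : 'M[R]_3 := map_mx intr hyp_matZ.
Definition phase_covec : 'cV[R]_3 := map_mx intr phase_covecZ.

Lemma hyp_mat_sym : hyp_mat^T = hyp_mat.
Proof.
apply/matrixP => i j; rewrite !mxE.
by case: (ord3P i) => ->; case: (ord3P j) => ->.
Qed.

Definition eigen_cubic (l : R) := l ^+ 3 - 2 * l ^+ 2 - l + 1.
Definition eigen_row (l : R) : V := \row_j [:: l ^+ 2 - l; l; l - 1]`_j.

Lemma eigen_row_eigen l : eigen_cubic l = 0 -> eigen_row l *m hyp_mat = l *: eigen_row l.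
Proof.
move=> h; apply/rowP => j; rewrite !mxE big_ord3 !mxE.
case: (ord3P j) => -> /=; rewrite /eigen_cubic in h; last 2 first; [ring|ring|].
have -> : l * (l ^+ 2 - l) = l ^+ 3 - l ^+ 2 by ring.
lra.
Qed.

(** The matrix is symmetric. *)
Lemma eigen_row_orthogonal l m : eigen_cubic l = 0 -> eigen_cubic m = 0 -> l != m ->
  eigen_row l *m (eigen_row m)^T = 0.
Proof.
move=> hl hm lm.
have e : l *: (eigen_row l *m (eigen_row m)^T) = m *: (eigen_row l *m (eigen_row m)^T).
  rewrite scalemxAl -(eigen_row_eigen hl) -mulmxA -{1}hyp_mat_sym -trmx_mul (eigen_row_eigen hm).
  by rewrite linearZ /= -scalemxAr.
move/eqP: e; rewrite -subr_eq0 -scalerBl scaler_eq0 subr_eq0 (negbTE lm) /=.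
by move/eqP.
Qed.

Definition eigen_row_sq (l : R) := (l ^+ 2 - l) ^+ 2 + l ^+ 2 + (l - 1) ^+ 2.

Lemma eigen_row_sqE l : eigen_row l *m (eigen_row l)^T = (eigen_row_sq l)%:M.
Proof.
apply/rowP => j; rewrite (ord1 j) !mxE big_ord3 !mxE /= mulr1n /eigen_row_sq; ring.
Qed.

Lemma eigen_row_sq_gt0 l : 0 < eigen_row_sq l.
Proof.
have h1 := sqr_ge0 (l ^+ 2 - l); have h2 := sqr_ge0 (2 * l - 1); rewrite /eigen_row_sq.
rewrite -addrA.
have -> : l ^+ 2 + (l - 1) ^+ 2 = ((2 * l - 1) ^+ 2 + 1) / 2 by field.
lra.
Qed.

Lemma eigen_row_phase l : (eigen_row l *m phase_covec) 0 0 = (l - 1) ^+ 2.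
Proof. rewrite mxE big_ord3 !mxE /=. ring. Qed.

(** The Galois group of the cubic is cyclic, generated by l |-> 1 / (1 - l).  So one
    root, located by a change of sign, gives the two others as 1 - 1/l and
    1 / (1 - l), together with their bounds. *)
Lemma eigenvalues_exist : exists lu lc ls : R,
  [/\ [/\ eigen_cubic lu = 0, eigen_cubic lc = 0 & eigen_cubic ls = 0],
      224/100 <= lu <= 225/100, -802/1000 <= lc <= -801/1000
    & 554/1000 <= ls <= 556/1000].
Proof.
pose p : {poly R} := 'X^3 - 2%:P * 'X^2 - 'X + 1%:P.
have pE x : p.[x] = eigen_cubic x by rewrite /p /eigen_cubic !hornerE.
have [||c /andP[c1 c2] /rootP] := @poly_ivt R p (-802/1000) (-801/1000).
- by lra.
- by rewrite !pE /eigen_cubic; apply/andP; split; lra.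
rewrite pE => hc.
have c0 : c != 0 by rewrite lt_eqF//; lra.
have c0' : 1 - c != 0 by rewrite gt_eqF//; lra.
exists (1 - c^-1), c, (1 - c)^-1.
have i1 : - c^-1 = (- c)^-1 by rewrite invrN.
split; rewrite ?c1 ?c2//.
- split=> //.
  + apply: (mulIf (expf_neq0 3 c0)); rewrite mul0r.
    transitivity (- eigen_cubic c); last by rewrite hc oppr0.
    by rewrite /eigen_cubic; field.
  + apply: (mulIf (expf_neq0 3 c0')); rewrite mul0r.
    transitivity (- eigen_cubic c); last by rewrite hc oppr0.
    by rewrite /eigen_cubic; field.
- have h : (- c^-1) * (- c) = 1 by rewrite i1 mulVf// oppr_eq0.
  have g1 : 124/100 <= - c^-1.
    by rewrite i1 -[leLHS]invrK lef_pV2 ?posrE ?invr_gt0; lra.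
  have g2 : - c^-1 <= 125/100.
    by rewrite i1 -[leRHS]invrK lef_pV2 ?posrE ?invr_gt0; lra.
  by apply/andP; split; lra.
- apply/andP; split.
    by rewrite -[leLHS]invrK lef_pV2 ?posrE ?invr_gt0; lra.
  by rewrite -[leRHS]invrK lef_pV2 ?posrE ?invr_gt0; lra.
Qed.

(** The components of the wave covector on two normalized eigenvectors, compared
    through their squares to avoid square roots. *)
Lemma phase_ratio (x y r : R) : 0 <= r ->
  (x - 1) ^+ 4 * eigen_row_sq y <= r ^+ 2 * ((y - 1) ^+ 4 * eigen_row_sq x) -> y != 1 ->
  `|((Num.sqrt (eigen_row_sq x))^-1 * (x - 1) ^+ 2)
    / ((Num.sqrt (eigen_row_sq y))^-1 * (y - 1) ^+ 2)| <= r.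
Proof.
move=> r0 h y1.
have nx := eigen_row_sq_gt0 x; have ny := eigen_row_sq_gt0 y.
have Y0 : (y - 1) ^+ 2 != 0 by rewrite expf_neq0// subr_eq0.
have p4 (z : R) : (z - 1) ^+ 4 = ((z - 1) ^+ 2) ^+ 2 by rewrite -exprM.
rewrite !p4 in h; move: ((x - 1) ^+ 2) ((y - 1) ^+ 2) Y0 h => X Y Y0 h.
have sx := sqr_sqrtr (ltW nx); have sy := sqr_sqrtr (ltW ny).
have sx0 : 0 < Num.sqrt (eigen_row_sq x) by rewrite sqrtr_gt0.
have sy0 : 0 < Num.sqrt (eigen_row_sq y) by rewrite sqrtr_gt0.
rewrite -sx -sy in h.
move: (Num.sqrt (eigen_row_sq x)) (Num.sqrt (eigen_row_sq y)) sx0 sy0 h => a b a0 b0 h.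
have -> : a^-1 * X / (b^-1 * Y) = (X * b) / (Y * a).
  by field; rewrite Y0 !gt_eqF.
rewrite normrM normfV ler_pdivrMr ?normr_gt0 ?mulf_neq0 ?(gt_eqF a0)//.
rewrite -(ger0_norm r0) -normrM -ler_sqr ?nnegrE ?normr_ge0//.
by rewrite !real_normK ?num_real// !exprMn.
Qed.

Definition diag3 (x y z : R) : 'M[R]_3 := \matrix_(i, j) ([:: x; y; z]`_i *+ (i == j)).

(** The last two bounds say that the wave covector is nearly aligned with the center
    direction; they control the off-diagonal terms of the derivative. *)
Lemma eigenbasis_exists : exists (P : 'M[R]_3) (lu lc ls : R),
  [/\ P *m P^T = 1%:M, P *m hyp_mat = diag3 lu lc ls *m P,
      [/\ 224/100 <= lu <= 225/100, -802/1000 <= lc <= -801/1000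
        & 554/1000 <= ls <= 556/1000],
      (P *m phase_covec) i1 0 != 0
    & `|(P *m phase_covec) i0 0 / (P *m phase_covec) i1 0| <= 4/10 /\
      `|(P *m phase_covec) i2 0 / (P *m phase_covec) i1 0| <= 24/100].
Proof.
have [lu [lc [ls [[hu hc hs] bu bc bs]]]] := eigenvalues_exist.
pose L (i : 'I_3) := [:: lu; lc; ls]`_i.
have hL i : eigen_cubic (L i) = 0 by case: (ord3P i) => ->.
pose P : 'M[R]_3 := \matrix_i ((Num.sqrt (eigen_row_sq (L i)))^-1 *: eigen_row (L i)).
have Pk i : (P *m phase_covec) i 0 = (Num.sqrt (eigen_row_sq (L i)))^-1 * (L i - 1) ^+ 2.
  have -> : (P *m phase_covec) i 0 = (row i (P *m phase_covec)) 0 0 by rewrite [RHS]mxE.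
  by rewrite row_mul rowK -scalemxAl mxE eigen_row_phase.
have Ldiff i j : i != j -> L i != L j.
  move: bu bc bs => /andP[g1 g2] /andP[g3 g4] /andP[g5 g6].
  clear -g1 g2 g3 g4 g5 g6.
  by case: (ord3P i) => ->; case: (ord3P j) => -> // _; rewrite /L /=;
    first [by rewrite lt_eqF//; lra | by rewrite gt_eqF//; lra].
have PP : P *m P^T = 1%:M.
  apply/matrixP => i j.
  have -> : (P *m P^T) i j = (row i P *m (row j P)^T) 0 0.
    by rewrite !mxE; apply: eq_bigr => k _; rewrite !mxE.
  rewrite !rowK linearZ /= -scalemxAl -scalemxAr.
  rewrite [RHS]mxE; case: eqP => [->|/eqP ij].
    rewrite eigen_row_sqE !mxE /= mulr1n mulrA -invfM -expr2.
    rewrite sqr_sqrtr ?(ltW (eigen_row_sq_gt0 _))//.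
    by rewrite mulVf// gt_eqF// eigen_row_sq_gt0.
  by rewrite (eigen_row_orthogonal (hL i) (hL j) (Ldiff _ _ ij)) !scaler0 mxE.
have PM : P *m hyp_mat = diag3 lu lc ls *m P.
  apply/row_matrixP => i; rewrite row_mul rowK -scalemxAl (eigen_row_eigen (hL i)).
  rewrite scalerA mulrC -scalerA.
  have -> : row i (diag3 lu lc ls *m P) = L i *: row i P.
    clearbody P; apply/rowP => j; rewrite !mxE (bigD1 i)//= big1 => [|k ki].
      by rewrite addr0 /diag3 mxE eqxx mulr1n.
    by rewrite /diag3 mxE eq_sym (negbTE ki) mulr0n mul0r.
  by rewrite rowK.
exists P, lu, lc, ls; split=> //.
- rewrite Pk /L /=; apply: mulf_neq0.
    by rewrite invr_eq0 gt_eqF// sqrtr_gt0 eigen_row_sq_gt0.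
  by apply: expf_neq0; rewrite lt_eqF//; case/andP: bc => _ ?; lra.
- have lc1 : lc != 1 by rewrite lt_eqF//; case/andP: bc => _ ?; lra.
  have p4 (x : R) : x ^+ 4 = (x ^+ 2) ^+ 2 by rewrite -exprM.
  have nc : eigen_row_sq lc <= 6.
    case/andP: bc => h1 h2; clear -h1 h2; rewrite /eigen_row_sq.
    have k1 : lc ^+ 2 <= (802/1000) ^+ 2.
      by rewrite -[lc ^+ 2]sqrrN; apply: sqr_le; lra.
    have k2 : (lc ^+ 2 - lc) ^+ 2 <= ((802/1000) ^+ 2 + 802/1000) ^+ 2.
      by apply: sqr_le; [have := sqr_ge0 lc; lra|lra].
    have -> : (lc - 1) ^+ 2 = lc ^+ 2 - 2 * lc + 1 by ring.
    lra.
  have dc : 105/10 <= (lc - 1) ^+ 4.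
    case/andP: bc => h1 h2; clear -h1 h2.
    have k1 : (1801/1000) ^+ 2 <= (1 - lc) ^+ 2 by apply: sqr_le; lra.
    have k2 : (1801/1000) ^+ 2 ^+ 2 <= (1 - lc) ^+ 2 ^+ 2.
      by apply: sqr_le k1; exact: sqr_ge0.
    have -> : (lc - 1) ^+ 4 = (1 - lc) ^+ 2 ^+ 2 by ring.
    lra.
  rewrite !Pk /L /=; clear -bu bs lc1 p4 nc dc.
  split; (apply: phase_ratio; [by clear; lra| |exact: lc1]).
  + case/andP: bu => h1 h2; clear bs.
    have n1 : 138/10 <= eigen_row_sq lu.
      rewrite /eigen_row_sq; clear -h1 h2.
      have k1 : (224/100) ^+ 2 <= lu ^+ 2 by apply: sqr_le; lra.
      have k2 : (27/10) ^+ 2 <= (lu ^+ 2 - lu) ^+ 2 by apply: sqr_le; lra.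
      have k3 : (124/100) ^+ 2 <= (lu - 1) ^+ 2 by apply: sqr_le; lra.
      lra.
    have d1 : (lu - 1) ^+ 4 <= 25/10.
      clear -h1 h2 p4.
      have k1 : (lu - 1) ^+ 2 <= (125/100) ^+ 2 by apply: sqr_le; lra.
      have k2 : (lu - 1) ^+ 2 ^+ 2 <= (125/100) ^+ 2 ^+ 2.
        by apply: sqr_le k1; exact: sqr_ge0.
      rewrite p4; lra.
    have m1 : (lu - 1) ^+ 4 * eigen_row_sq lc <= 25/10 * 6.
      by apply: (ler_pM _ _ d1 nc); [rewrite p4; exact: sqr_ge0|exact/ltW/eigen_row_sq_gt0].
    have m2 : 105/10 * (138/10) <= (lc - 1) ^+ 4 * eigen_row_sq lu.
      by apply: (ler_pM _ _ dc n1); clear; lra.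
    by clear -m1 m2; lra.
  + case/andP: bs => h1 h2; clear bu.
    have n1 : 56/100 <= eigen_row_sq ls.
      rewrite /eigen_row_sq; clear -h1 h2.
      have k1 : (554/1000) ^+ 2 <= ls ^+ 2 by apply: sqr_le; lra.
      have k1' : ls ^+ 2 <= (556/1000) ^+ 2 by apply: sqr_le; lra.
      have k2 : (244/1000) ^+ 2 <= (ls - ls ^+ 2) ^+ 2 by apply: sqr_le; lra.
      have k3 : (444/1000) ^+ 2 <= (1 - ls) ^+ 2 by apply: sqr_le; lra.
      have -> : (ls ^+ 2 - ls) ^+ 2 = (ls - ls ^+ 2) ^+ 2 by ring.
      have -> : (ls - 1) ^+ 2 = (1 - ls) ^+ 2 by ring.
      lra.
    have d1 : (ls - 1) ^+ 4 <= 4/100.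
      clear -h1 h2.
      have k1 : (1 - ls) ^+ 2 <= (446/1000) ^+ 2 by apply: sqr_le; lra.
      have k2 : (1 - ls) ^+ 2 ^+ 2 <= (446/1000) ^+ 2 ^+ 2.
        by apply: sqr_le k1; exact: sqr_ge0.
      have -> : (ls - 1) ^+ 4 = (1 - ls) ^+ 2 ^+ 2 by ring.
      lra.
    have m1 : (ls - 1) ^+ 4 * eigen_row_sq lc <= 4/100 * 6.
      by apply: (ler_pM _ _ d1 nc); [rewrite p4; exact: sqr_ge0|exact/ltW/eigen_row_sq_gt0].
    have m2 : 105/10 * (56/100) <= (lc - 1) ^+ 4 * eigen_row_sq ls.
      by apply: (ler_pM _ _ dc n1); clear; lra.
    by clear -m1 m2; lra.
Qed.

End Eigenbasis.

(** * The perturbed automorphism *)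

Section InducedMaps.
Variable R : realType.
Local Notation V := 'rV[R]_3.
Local Notation T := (torus R).

Definition induced (F : V -> V) (p : T) : T := tproj (F (trepr p)).

(** The condition under which a map of the covering space descends to the torus. *)
Definition lattice_equivariant (F : V -> V) := forall x (k : 'rV[int]_3),
  exists l : 'rV[int]_3, F (x + map_mx intr k) = F x + map_mx intr l.

Lemma induced_tproj F x : lattice_equivariant F ->
  induced F (tproj x) = tproj (F x).
Proof.
move=> hF; have /tprojP[k e] : tproj (trepr (tproj x)) = tproj x by rewrite treprK.
have [l el] := hF x k.
rewrite /induced (_ : trepr _ = x + map_mx intr k) ?el ?tprojD//.
by rewrite -e addrC subrK.
Qed.

Lemma induced_Ck k F : lattice_equivariant F -> Ck_on k setT F ->
  torus_Ck k (induced F).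
Proof.
move=> hF cF x; exists setT, F; split=> //; first exact: openT.
by move=> y _; rewrite induced_tproj.
Qed.

Lemma induced_cancel F G : lattice_equivariant G -> cancel F G ->
  cancel (induced F) (induced G).
Proof.
by move=> hG FK p; rewrite {2}/induced induced_tproj// FK treprK.
Qed.

Lemma is_tangent_induced F x A : lattice_equivariant F -> differentiable F x ->
  A = jacobian F x -> is_tangent (induced F) x A.
Proof.
move=> hF dF AE; exists F; split=> //.
by near=> y; rewrite induced_tproj.
Unshelve. all: by end_near. Qed.

Lemma sin_periodic (t : R) (n : int) :
  sin (2 * pi * (t + n%:~R)) = sin (2 * pi * t) :> R.
Proof.
have pos (m : nat) (s : R) : sin (2 * pi * (s + m%:R)) = sin (2 * pi * s) :> R.
  rewrite mulrDr -(periodicn (@sinD2pi R) m (2 * pi * s)); congr (sin (_ + _)).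
  by rewrite -[pi *+ 2 *+ m]mulr_natr -[pi *+ 2]mulr_natl.
case: n => m; first exact: pos.
by rewrite NegzE intrN -[in RHS](subrK (m.+1%:R) t) pos.
Qed.

End InducedMaps.

Lemma phaseD (K : comPzRingType) n (v w : 'rV[K]_n) (c : K) (l : 'cV[K]_n) :
  ((v + c *: w) *m l) 0 0 = (v *m l) 0 0 + c * (w *m l) 0 0.
Proof. by rewrite mulmxDl -scalemxAl !mxE. Qed.

Lemma phase_balance (K : numFieldType) (q l k p s h : K) :
  l != 0 -> k != 0 -> p != 0 ->
  h + - (q / (2 * p * k) / l * s) * k = h + - q / l / (2 * p) * s.
Proof. by move=> l0 k0 p0; field; rewrite l0 k0 p0. Qed.

Section Model.
Variable R : realType.
Local Notation V := 'rV[R]_3.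
Local Notation T := (torus R).
Local Notation tau := (2 * pi : R).
Variables (P : 'M[R]_3) (lu lc ls : R).
Hypothesis PP : P *m P^T = 1%:M.
Hypothesis PM : P *m hyp_mat R = diag3 lu lc ls *m P.
Hypothesis lc_bounds : -802/1000 <= lc <= -801/1000.
Let kap := (P *m phase_covec R) i1 0.
Hypothesis kap_neq0 : kap != 0.
Let ec := row i1 P.
Let amp := 1/5 / (tau * kap).

Let lc_neq0 : lc != 0.
Proof. by rewrite lt_eqF//; case/andP: lc_bounds => _; lra. Qed.

Let pi_neq0 : (pi : R) != 0. Proof. by rewrite gt_eqF ?pi_gt0. Qed.

Definition hyp_mat_inv : 'M[R]_3 := map_mx intr hyp_matZ_inv.

Lemma hyp_mat_mulV : hyp_mat R *m hyp_mat_inv = 1%:M.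
Proof. by rewrite -map_mxM hyp_matZ_mulV map_mx1. Qed.

Lemma hyp_mat_Vmul : hyp_mat_inv *m hyp_mat R = 1%:M.
Proof. by rewrite -map_mxM hyp_matZ_Vmul map_mx1. Qed.

Lemma center_eigen : ec *m hyp_mat R = lc *: ec.
Proof.
rewrite /ec -row_mul PM row_mul.
have -> : row i1 (diag3 lu lc ls) = lc *: delta_mx 0 i1.
  apply/rowP => j; rewrite !mxE /=.
  by case: (ord3P j) => -> /=; rewrite ?mulr0 ?mulr1.
by rewrite -scalemxAl -rowE.
Qed.

Lemma center_eigen_inv : ec *m hyp_mat_inv = lc^-1 *: ec.
Proof.
rewrite -[LHS](scalerK lc_neq0) scalemxAl -center_eigen -mulmxA hyp_mat_mulV mulmx1//.
Qed.

Lemma center_phase : (ec *m phase_covec R) 0 0 = kap.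
Proof. by rewrite /ec -row_mul mxE. Qed.

Let delta := - (1/5) / lc.

Lemma delta_small : `|delta| <= 1/2.
Proof.
case/andP: lc_bounds => h1 h2.
rewrite /delta normrM normfV (ler0_norm (x := lc)); last lra.
rewrite ler_pdivrMr; last lra.
by rewrite normrN ger0_norm; lra.
Qed.

Let H := phase_inv delta.

(** The automorphism followed by a push of amplitude [amp] along the center
    direction. *)
Definition da_lift : V -> V :=
  wave 0 (hyp_mat R) (phase_covec R) (fun t => - amp * sin (tau * t)) ec.
(** The image point determines the phase of its preimage through the scalar map
    [phase], hence the length of the push that has to be undone. *)
Definition da_lift_inv : V -> V :=
  wave 0 hyp_mat_inv (hyp_mat_inv *m phase_covec R) (fun t => amp / lc * sin (tau * H t)) ec.

Lemma da_lift_invK : cancel da_lift_inv da_lift.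
Proof.
move=> y; set t := (y *m (hyp_mat_inv *m phase_covec R)) 0 0.
have xk : (da_lift_inv y *m phase_covec R) 0 0 = H t.
  rewrite /da_lift_inv /wave add0r phaseD -mulmxA -/t center_phase.
  have : phase delta (H t) = t by exact: phase_invK.
  rewrite /phase => e.
  rewrite -{1}e -(phase_balance _ _ _ lc_neq0 kap_neq0 pi_neq0) -/amp.
  by rewrite -addrA mulNr addNr addr0.
rewrite /da_lift /wave add0r xk /da_lift_inv /wave add0r -/t mulmxDl -mulmxA hyp_mat_Vmul mulmx1.
rewrite -scalemxAl center_eigen scalerA -addrA -scalerDl.
by rewrite [X in X *: _](_ : _ = 0) ?scale0r ?addr0//; field; rewrite lc_neq0.
Qed.

Lemma da_liftK : cancel da_lift da_lift_inv.
Proof.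
move=> x; set t := (x *m phase_covec R) 0 0.
have yE : da_lift x *m hyp_mat_inv = x - (amp / lc * sin (tau * t)) *: ec.
  rewrite /da_lift /wave add0r mulmxDl -mulmxA hyp_mat_mulV mulmx1 -/t -scalemxAl.
  have e (s : R) : - amp * s / lc = - (amp / lc * s) by ring.
  by rewrite center_eigen_inv scalerA e scaleNr.
have yk : (da_lift x *m (hyp_mat_inv *m phase_covec R)) 0 0 = phase delta t.
  rewrite mulmxA yE -scaleNr phaseD -/t center_phase.
  exact: phase_balance.
rewrite /da_lift_inv /wave add0r yE yk /H phaseK ?subrK//.
exact: delta_small.
Qed.

Lemma da_lift_shift x (k : 'rV[int]_3) :
  da_lift (x + map_mx intr k) = da_lift x + map_mx intr (k *m hyp_matZ).
Proof.
rewrite /da_lift /wave !add0r -[map_mx _ k]scale1r phaseD scale1r mul1r mulmxDl.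
by rewrite -!map_mxM [map_mx _ _ 0 0]mxE sin_periodic addrAC.
Qed.

Lemma da_lift_equivariant : lattice_equivariant da_lift.
Proof. by move=> x k; exists (k *m hyp_matZ); exact: da_lift_shift. Qed.

Lemma da_lift_inv_equivariant : lattice_equivariant da_lift_inv.
Proof.
move=> y k; exists (k *m hyp_matZ_inv); apply: (can_inj da_liftK).
by rewrite da_lift_shift !da_lift_invK -mulmxA hyp_matZ_Vmul mulmx1.
Qed.

Definition da_map : T -> T := induced da_lift.

Lemma da_map_smooth : smooth_diffeo da_map.
Proof.
move=> n; split.
  apply: induced_Ck; first exact: da_lift_equivariant.
  (* With delta = 0 the inverse phase is the identity, so that the same algebra of
     functions serves for the map itself. *)
  have d0 : `|0 : R| <= 1/2 by rewrite normr0; lra.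
  apply: Ck_wave (phase_algebra_closed d0) _.
  have -> : (fun t => - amp * sin (tau * t)) =
      (cst (- amp) * (fun t : R => sin (tau * phase_inv 0 t))).
    apply/funext => t; rewrite !fctE; congr (_ * sin (tau * _)).
    by rewrite -{1}(phase_invK 0 t) /phase mul0r mul0r addr0.
  by apply: PAmul; [exact: PAcst|exact: PAsin].
exists (induced da_lift_inv); split.
- exact: induced_cancel da_lift_inv_equivariant da_liftK.
- exact: induced_cancel da_lift_equivariant da_lift_invK.
- apply: induced_Ck; first exact: da_lift_inv_equivariant.
  apply: Ck_wave (phase_algebra_closed delta_small) _.
  have -> : (fun t => amp / lc * sin (tau * H t)) =
      (cst (amp / lc) * (fun t : R => sin (tau * H t))) by [].
  by apply: PAmul; [exact: PAcst|exact: PAsin].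
Qed.

(** The derivative of the push along the center direction; it is added to the center
    eigenvalue. *)
Definition tilt (x : V) : R := - (1/5) * cos (tau * (x *m phase_covec R) 0 0).

Lemma tilt_le x : `|tilt x| <= 1/5.
Proof.
have h1 := cos_geN1 (tau * (x *m phase_covec R) 0 0).
have h2 := cos_le1 (tau * (x *m phase_covec R) 0 0).
by rewrite /tilt ler_norml; apply/andP; split; lra.
Qed.

Definition da_jacobian (x : V) : 'M[R]_3 := hyp_mat R + (tilt x / kap) *: (phase_covec R *m ec).

Lemma tangent_da_map x : tangent da_map (tproj x) = da_jacobian x.
Proof.
pose u' := fun t : R => - (1/5) * cos (tau * t) / kap.
have du (t : R) : is_derive t (1 : R) (fun t => - amp * sin (tau * t)) (u' t).
  have h2 := @is_derive1_comp R (@sin R) ( *%R tau) t _ _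
    (is_derive_sin (tau * t)) (is_derive_scale tau t).
  have h3 := is_deriveZ (- amp) h2.
  apply: (is_derive_eq h3); rewrite /u' /amp /GRing.scale /=.
  by move: (cos _) => c; move: (pi : R) pi_neq0 => p p0; field; rewrite kap_neq0.
have dF : differentiable da_lift x by exact: differentiable_wave.
apply: tangentE; apply: is_tangent_induced; [exact: da_lift_equivariant|exact: dF|].
apply: eq_mulrow => v; apply: esym; apply: (etrans (mulrow_jacobian v dF)).
rewrite /da_lift (derive_wave _ _ _ _ _ _ du) /wave mulmx0 addr0 /da_jacobian mulmxDr.
congr (_ + _); rewrite -scalemxAr mulmxA /u' -/(tilt x); congr (_ *: _).
by rewrite [v *m phase_covec R]mx11_scalar mul_scalar_mx mxE mulr1n.
Qed.

(** The derivative of the perturbed automorphism in the eigenbasis. *)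
Definition model_mx (p m r : R) : 'M[R]_3 := \matrix_(i, j)
  (nth [::] [:: [:: lu; p; 0]; [:: 0; m; 0]; [:: 0; r; ls]] i)`_j.

Let rho i := (P *m phase_covec R) i 0 / kap.

Lemma da_map_coordinates x : P *m tangent da_map (tproj x) *m P^T =
  model_mx (tilt x * rho i0) (lc + tilt x) (tilt x * rho i2).
Proof.
rewrite tangent_da_map /da_jacobian mulmxDr mulmxDl PM -mulmxA PP mulmx1.
rewrite -scalemxAr -scalemxAl !mulmxA -(mulmxA _ ec).
have -> : ec *m P^T = delta_mx 0 i1 by rewrite /ec -row_mul PP row1.
have kapE : (P *m phase_covec R) i1 0 = kap by [].
move: kapE; rewrite /rho; move: (P *m phase_covec R) => K kapE.
have KE i j : (K *m (delta_mx 0 i1 : V)) i j = K i 0 * (j == i1)%:R.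
  by rewrite mxE big_ord1 mxE eqxx.
have addE (A B : 'M[R]_3) (w : R) i j : (A + w *: B) i j = A i j + w * B i j.
  by rewrite !mxE.
apply/matrixP => i j; rewrite addE KE /diag3 /model_mx !mxE.
have e : tilt x / kap * kap = tilt x by rewrite divfK.
by case: (ord3P i) => ->; case: (ord3P j) => -> /=;
  rewrite ?mulr1n ?mulr0n ?mulr0 ?addr0 ?add0r ?mulr1 ?kapE ?e//;
  rewrite mulrAC mulrA.
Qed.

End Model.

(** * The splitting into three line bundles *)

Section LineFields.
Variable R : realType.
Local Notation V := 'rV[R]_3.
Local Notation T := (torus R).
Variables (g : T -> T) (P : 'M[R]_3) (C : T -> 'M[R]_3).
Hypothesis tg : has_tangents g.
Hypothesis PP : P *m P^T = 1%:M.
Hypothesis CE : forall p, tangent g p = P^T *m C p *m P.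
Variables (w : T -> V) (t : T -> R).
Hypothesis wE : forall p, w p *m C p = t p *: w (g p).

Definition span_field p := <<w p *m P>>%MS.

Lemma span_field_memP p (v : V) :
  reflect (exists k, v = k *: (w p *m P)) (v <= span_field p)%MS.
Proof. by rewrite genmxE; exact: sub_rVP. Qed.

Lemma span_field_step p : w p *m P *m tangent g p = t p *: (w (g p) *m P).
Proof. by rewrite CE (conj_mul PP (fun _ => erefl) (w p) p) wE scalemxAl. Qed.

(** A line field spanned by rows that are mapped to multiples of each other: all its
    growth rates are read off the multipliers. *)
Lemma span_field_iter (lo hi : R) n p : 0 <= lo -> 0 <= hi ->
  (forall q, lo <= `|t q| <= hi) ->
  exists2 k, w p *m P *m tangent (iter n g) p = k *: (w (iter n g p) *m P)
    & lo ^+ n <= `|k| <= hi ^+ n.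
Proof.
move=> lo0 hi0 h; elim: n => [|n [k kE /andP[k1 k2]]].
  by exists 1; rewrite ?tangent_id ?mulmx1 ?scale1r// normr1 !expr0 lexx.
exists (k * t (iter n g p)).
  by rewrite (tangent_iterS tg) mulmxA kE -scalemxAl span_field_step scalerA.
have /andP[h1 h2] := h (iter n g p).
by rewrite normrM !exprSr; apply/andP; split; apply: ler_pM; rewrite ?exprn_ge0.
Qed.

Lemma span_field_invariant : (forall p, t p != 0) -> invariant_bundle g span_field.
Proof.
move=> t0 p.
have E : (span_field p *m tangent g p :=: span_field (g p))%MS.
  apply: eqmx_trans (eqmxMr _ (genmxE _)) _; rewrite span_field_step.
  exact: eqmx_trans (eqmx_scale _ (t0 p)) (eqmx_sym (genmxE _)).
by rewrite !E !submx_refl.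
Qed.

Lemma span_field_rank p : w p != 0 -> \rank (span_field p) = 1%N.
Proof. by move=> w0; rewrite genmxE mxrankMfree ?(isometry_row_free PP)// rank_rV w0. Qed.

Lemma span_field_continuous (N0 N1 : V) (u : T -> R) :
  (forall p, w p = N0 + u p *: N1) -> lift_continuous u -> (forall p, w p != 0) ->
  continuous_bundle span_field.
Proof.
move=> wu cu w0 x; exists 1%N, (fun y => w (tproj y) *m P).
near=> y; split.
- have -> : (fun y : V => w (tproj y) *m P) =
    (fun y => N0 *m P + (u \o @tproj R) y *: (N1 *m P) + cst 0 y *: (N1 *m P)).
    by apply/funext => z; rewrite wu mulmxDl -scalemxAl scale0r addr0.
  by apply: continuous_affine_frame; [exact: (cu y)|exact: cst_continuous].
- by rewrite /row_free mxrankMfree ?(isometry_row_free PP)// rank_rV w0.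
- by rewrite /span_field !genmxE !submx_refl.
Unshelve. all: by end_near. Qed.

End LineFields.

Lemma center_norm_bounds (K : realFieldType) (x : K) :
  -1002/1000 <= x <= -601/1000 -> 601/1000 <= `|x| <= 1002/1000.
Proof.
move=> /andP[h1 h2]; rewrite ler0_norm; last by lra.
by apply/andP; split; lra.
Qed.

Section ModelSplitting.
Variable R : realType.
Local Notation V := 'rV[R]_3.
Local Notation T := (torus R).
Variables (f : T -> T) (P : 'M[R]_3) (lu ls : R) (al mu ga : T -> R).
Let C p := model_mx lu ls (al p) (mu p) (ga p).
Hypothesis fd : Ck_diffeo 1 f.
Hypothesis PP : P *m P^T = 1%:M.
Hypothesis CE : forall p, tangent f p = P^T *m C p *m P.
Hypothesis cmu : lift_continuous mu.
Hypothesis cga : lift_continuous ga.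
Hypothesis cC : forall i j, lift_continuous (fun p => C p i j).
Hypothesis dC : forall p, dominated_mx (C p).
Hypothesis ls_bounds : 554/1000 <= ls <= 556/1000.
Hypothesis mu_bounds : forall p, -1002/1000 <= mu p <= -601/1000.
Hypothesis ga_bound : forall p, `|ga p| <= 48/1000.

Let tg : has_tangents f.
Proof. by move=> x; apply: C1_is_tangent; case: fd. Qed.

Let fu p : tangent f p \in unitmx.
Proof. exact: diffeo_tangent_unit. Qed.

Definition center_vec : V := delta_mx 0 i1.
Definition stable_vec (s : R) : V := \row_j [:: 0; s; 1]`_j.

Lemma stable_vec_affine s : stable_vec s = stable_vec 0 + s *: center_vec.
Proof.
by apply/rowP => j; rewrite !mxE; case: (ord3P j) => -> /=;
  rewrite ?mulr0 ?mulr1 ?addr0 ?add0r.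
Qed.

Lemma stable_vec_neq0 s : stable_vec s != 0.
Proof.
apply/eqP => /rowP /(_ i2); rewrite !mxE /= => /eqP.
by rewrite oner_eq0.
Qed.

Lemma center_vec_neq0 : center_vec != 0.
Proof.
apply/eqP => /rowP /(_ i1); rewrite !mxE /= => /eqP.
by rewrite oner_eq0.
Qed.

Lemma center_vec_model p : center_vec *m C p = mu p *: center_vec.
Proof.
apply/rowP => j; rewrite mxE big_ord3 !mxE.
by case: (ord3P j) => -> /=; rewrite ?mul0r ?mulr0 ?addr0 ?add0r ?mul1r ?mulr1.
Qed.

Lemma stable_vec_model s p :
  stable_vec s *m C p = (s * mu p + ga p) *: center_vec + ls *: stable_vec 0.
Proof.
apply/rowP => j; rewrite mxE big_ord3 !mxE.
by case: (ord3P j) => -> /=;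
  rewrite ?mul0r ?mulr0 ?addr0 ?add0r ?mul1r ?mulr1.
Qed.

(** The stable direction s + sigma c is invariant when [sigma] solves this
    cohomological equation.  Solved for [sigma] at the source it is a contraction
    along the dynamics, because the center multiplier dominates the stable
    eigenvalue at each point. *)
Lemma stable_section : exists s : T -> R, [/\ lift_continuous s,
  forall p, `|s p| <= 2 & forall p, s p * mu p + ga p = ls * s (f p)].
Proof.
have mun p : mu p != 0.
  by rewrite lt_eqF//; have /andP[_ ?] := mu_bounds p; lra.
(* The ball of radius 2 is preserved as (2 * 0.556 + 0.048) / 0.601 < 2, and the
   Lipschitz constant is 0.556 / 0.601 < 95/100. *)
pose Phi p (v : 'rV[R]_1) : 'rV[R]_1 := \row_j ((ls * v 0 0 - ga p) / mu p).
have munorm p : 601/1000 <= `|mu p|.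
  by case/andP: (center_norm_bounds (mu_bounds p)).
have [ls1 ls2] := andP ls_bounds.
have lsn : `|ls| <= 556/1000 by rewrite ger0_norm; lra.
have [f1 _] := fd.
have [||p v hv|p v v' hv hv'|s hs sB|s [cs sB sE]] :=
  @invariant_section R 1 f Phi 2 (95/100).
- by lra.
- by apply/andP; split; lra.
- move/row_normP: hv => [_ hv]; apply/row_normP; split=> [|j]; first lra.
  rewrite mxE normrM normfV ler_pdivrMr; last by have := munorm p; lra.
  apply: le_trans (ler_normB _ _) _.
  have := ler_norm_mul lsn (hv 0); have := ga_bound p; have := munorm p; lra.
- have /row_normP[n0 hd] : `|v - v'| <= `|v - v'| by [].
  apply/row_normP; split=> [|j]; first by apply: mulr_ge0 => //; lra.
  rewrite !mxE -mulrBl opprB addrA subrK -mulrBr normrM normfV.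
  rewrite ler_pdivrMr; last by have := munorm p; lra.
  have hd0 : `|v 0 0 - v' 0 0| <= `|v - v'| by have := hd 0; rewrite !mxE.
  apply: le_trans (ler_norm_mul lsn hd0) _.
  have := ler_wpM2l n0 (munorm p); lra.
- move=> x; apply: continuous_row => j.
  have -> : (fun y : V => Phi (tproj y) (s (f (tproj y))) 0 j) =
      (fun p => (ls * s (f p) 0 0 + (-1) * ga p) / mu p) \o @tproj R.
    by apply/funext => y; rewrite /= mxE mulN1r.
  move: x; apply: lift_continuous_div => //.
  apply: lift_continuousD; apply: lift_continuousM => //; try exact: lift_continuous_cst.
  have hs0 : lift_continuous (fun p => s p 0 0) by exact: lift_continuous_coord.
  exact: (C1_lift_continuous_comp (torus_C1_C0 f1) hs0).
exists (fun p => s p 0 0); split.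
- exact: lift_continuous_coord.
- by move=> p; have /row_normP[_ h] := sB p; exact: h.
- by move=> p; rewrite {1}sE mxE divfK// subrK.
Qed.

(** The conormal of the center-stable plane is the first basis vector, so this plane
    is constant and equal to the sum of the center and the stable lines; the
    domination of the center by the strong unstable line is inherited from it. *)
Theorem model_splitting : exists Eu Ec Fs : T -> 'M[R]_3,
  [/\ ph_splitting3 f Eu Ec Fs, ph_splitting f Eu (sum_bundle Ec Fs)
    & volume_expanding_along f Eu].
Proof.
have [a [b [t [ca cb ab_le t_ge abE]]]] := dominated_sections fd cC dC.
have [s [cs sB sE]] := stable_section.
have zcd (p : T) : `|cst (0 : R) p| <= 1/10 /\ `|cst (0 : R) p| <= 1/10.
  by rewrite /= normr0; split; lra.
have cdE p : graph_row (cst 0 (f p)) (cst 0 (f p)) *m (C p)^T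
    = lu *: graph_row (cst 0 p) (cst 0 p).
  apply/rowP => j; rewrite mxE big_ord3 !mxE /=.
  by case: (ord3P j) => -> /=; rewrite ?mul0r ?mulr0 ?addr0 ?add0r ?mul1r ?mulr1.
have c0 : lift_continuous (cst 0 : T -> R) by exact: lift_continuous_cst.
pose Eu := line_bundle P a b.
pose Ec := span_field P (fun _ : T => center_vec).
pose Fs := span_field P (fun p => stable_vec (s p)).
have ph := sections_ph_splitting tg fu PP CE dC ca cb c0 c0 ab_le zcd t_ge abE cdE.
have vol := sections_volume_expanding PP CE dC ab_le t_ge abE.
have sumE : sum_bundle Ec Fs = plane_bundle P (cst 0) (cst 0).
  apply/funext => p; rewrite /sum_bundle /Ec /Fs /span_field -genmx_adds.
  apply/eq_genmx => /=; apply: eqmx_trans (eqmx_sym (addsmxMr _ _ _)) _.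
  apply: eqmxMr; apply/eqmxP/andP; split.
    rewrite addsmx_sub; apply/andP; split; apply/cs_frame_memP;
      rewrite !mxE /=; ring.
  apply/row_subP => i; set x := row i _.
  have /cs_frame_memP x0 : (x <= cs_frame 0 0)%MS by exact: row_sub.
  clearbody x.
  have -> : x = (x 0 i1 - x 0 i2 * s p) *: center_vec + x 0 i2 *: stable_vec (s p).
    apply/rowP => j; rewrite ![in RHS]mxE; case: (ord3P j) => -> /=; last 2 first.
    - ring.
    - ring.
    - rewrite x0; ring.
  apply: addmx_sub_adds; exact: scalemx_sub.
have stE p : stable_vec (s p) *m C p = ls *: stable_vec (s (f p)).
  rewrite stable_vec_model sE [stable_vec (s (f p))]stable_vec_affine.
  by rewrite scalerDr scalerA addrC.
have [ls1 ls2] := andP ls_bounds.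
have rankEu p : \rank (Eu p) = 1%N by exact: line_rank.
have rankEc p : \rank (Ec p) = 1%N.
  by apply: (span_field_rank PP); exact: center_vec_neq0.
have rankFs p : \rank (Fs p) = 1%N.
  by apply: (span_field_rank PP); exact: stable_vec_neq0.
have [_ [invEu _] _ full [c1 [s1 [c10 s11 expEu domEu]]]] := ph.
have EcS p : (Ec p <= plane_bundle P (cst 0) (cst 0) p)%MS.
  by rewrite -sumE; exact: addsmxSl.
have ecE n p (v : V) : (v <= Ec p)%MS ->
    (601/1000) ^+ n * enorm v <= enorm (v *m tangent (iter n f) p).
  move=> /span_field_memP[k ->].
  have lo0 : (0 : R) <= 601/1000 by lra.
  have hi0 : (0 : R) <= 1002/1000 by lra.
  have mub q : 601/1000 <= `|mu q| <= 1002/1000 by exact: center_norm_bounds.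
  have [l lE /andP[l1 _]] := span_field_iter tg PP CE center_vec_model n p lo0 hi0 mub.
  rewrite -scalemxAl lE !enormZ; have e0 := enorm_ge0 (center_vec *m P).
  by rewrite mulrCA ler_wpM2l// ler_wpM2r.
have svn q : 1 <= enorm (stable_vec (s q) *m P) <= 3.
  rewrite (enorm_isometry _ PP) enormE !mxE /=.
  have h := sqr_le (normr_ge0 _) (sB q); rewrite real_normK ?num_real// in h.
  have h2 := sqr_ge0 (s q); apply/andP; split.
    by rewrite -[leLHS]sqrtr1 ler_sqrt; lra.
  have -> : (3 : R) = Num.sqrt (3 ^+ 2) by rewrite sqrtr_sqr ger0_norm.
  by rewrite ler_sqrt; lra.
have fsE n p (v : V) : (v <= Fs p)%MS ->
    enorm (v *m tangent (iter n f) p) <= 3 * (556/1000) ^+ n * enorm v.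
  move=> /span_field_memP[k ->].
  have lo0 : (0 : R) <= 0 by [].
  have hi0 : (0 : R) <= 556/1000 by lra.
  have lsb (q : T) : 0 <= `|ls| <= 556/1000.
    by rewrite normr_ge0 /= ger0_norm; lra.
  have [l lE /andP[_ l2]] := span_field_iter tg PP CE stE n p lo0 hi0 lsb.
  rewrite -scalemxAl lE !enormZ.
  have /andP[n1 _] := svn p; have /andP[_ n3] := svn (iter n f p).
  rewrite [leRHS](_ : _ = `|k| * ((556/1000) ^+ n * 3 * enorm (stable_vec (s p) *m P)));
    last by ring.
  apply: ler_wpM2l => //; rewrite -mulrA; apply: ler_pM => //; first exact: enorm_ge0.
  by apply: le_trans n3 _; rewrite ler_peMr.
exists Eu, Ec, Fs; split; [split|by rewrite sumE|exact: vol].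
- split.
  + exact: line_bundle_continuous.
  + apply: (@span_field_continuous _ _ PP _ center_vec 0 (cst 0)) => // p.
      by rewrite /= scale0r addr0.
    exact: center_vec_neq0.
  + apply: (@span_field_continuous _ _ PP _ (stable_vec 0) center_vec s) => // p.
      exact: stable_vec_affine.
    exact: stable_vec_neq0.
- split; first exact: invEu.
    apply: (span_field_invariant PP CE center_vec_model) => p.
    by rewrite lt_eqF//; have /andP[_ ?] := mu_bounds p; lra.
  by apply: (span_field_invariant PP CE stE) => p; rewrite gt_eqF//; lra.
- by move=> p; split.
- move=> p; have [_ fullp] := full p.
  have r3 : \rank (Eu p + Ec p + Fs p)%MS = 3%N.
    by rewrite -addsmxA -[(Ec p + Fs p)%MS]/(sum_bundle Ec Fs p) sumE; apply/eqP.
  split; last by rewrite /row_full r3.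
  by apply/mxdirectP; rewrite /= r3 rankEu rankEc rankFs.
- split.
  + exists c1, s1; split=> // n p v1 v2 n1 h1 h2.
    exact: domEu n p v1 v2 n1 h1 (submx_trans h2 (EcS p)).
  (* The factor 3 bounds the ratio of the norms of two rows [stable_vec (s _)]. *)
  + exists (1/3), (601/556); split; [by lra|by lra|].
    move=> n p v1 v2 _ h1 h2 e1 e2.
    have k1 := ecE n p v1 h1; have k2 := fsE n p v2 h2.
    rewrite e1 mulr1 in k1; rewrite e2 mulr1 in k2.
    have pos : 0 < enorm (v2 *m tangent (iter n f) p).
      rewrite enorm_gt0; apply/eqP => h0.
      have un := tangent_iter_unit tg n p fu.
      move: e2; rewrite -(mulmxK un v2) h0 mul0mx /enorm big1 ?sqrtr0 => [/eqP|i _].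
        by rewrite eq_sym oner_eq0.
      by rewrite mxE expr0n.
    rewrite ler_pdivlMr//; apply: le_trans k1.
    have -> : (601/1000) ^+ n = 1/3 * (601/556) ^+ n * (3 * (556/1000) ^+ n) :> R.
      have -> : 601/1000 = 601/556 * (556/1000) :> R by field.
      by rewrite exprMn; field.
    apply: ler_wpM2l k2; apply: mulr_ge0; first by lra.
    by apply: exprn_ge0; lra.
  + by exists c1, s1.
  + exists 3, (556/1000); split; [by lra|by apply/andP; split; lra|].
    by move=> n p v _; exact: fsE.
Qed.

End ModelSplitting.

(** * The saddle, the perturbations and the theorem *)

Section Saddle.
Variable R : realType.
Local Notation V := 'rV[R]_3.
Variables (P A : 'M[R]_3) (lu ls p m r : R).
Hypothesis PP : P *m P^T = 1%:M.
Hypothesis AE : A = P^T *m model_mx lu ls p m r *m P.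
Hypothesis Au : A \in unitmx.
Hypothesis lu1 : 1 < lu.
Hypothesis m1 : m < -1.
Hypothesis ls01 : 0 < ls < 1.

Let toC := real_complex R.

Lemma real_complex_norm_neq1 (x : R) : `|x| != 1 -> `|toC x| != 1.
Proof.
apply: contra; rewrite normc_def /= expr0n /= addr0 sqrtr_sqr.
by move=> /eqP h; apply/eqP/complexI.
Qed.

(** In the eigenbasis the matrix is triangular after a permutation of the basis, so
    the diagonal entries are the only eigenvalues. *)
Lemma saddle_hyperbolic : hyperbolic_mx A.
Proof.
split=> // z /eigenvalueP[v vz v0].
pose Q := map_mx toC P.
have QQ : Q *m Q^T = 1%:M by rewrite /Q map_trmx -map_mxM PP map_mx1.
pose x := v *m Q^T.
have vx : v = x *m Q by rewrite /x -mulmxA (mulmx1C QQ) mulmx1.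
have xz : x *m map_mx toC (model_mx lu ls p m r) = z *: x.
  rewrite /x scalemxAl -vz AE !map_mxM -map_trmx -/Q.
  by rewrite -!mulmxA QQ mulmx1.
have x0 : x != 0 by apply: contra v0 => /eqP h; rewrite vx h mul0mx.
clearbody x.
have e j := congr1 (fun M : 'rV_3 => M 0 j) xz.
have toC0 : toC 0 = 0 by exact: rmorph0.
have e0 : x 0 i0 * toC lu = z * x 0 i0.
  by move: (e i0); rewrite mxE big_ord3 !mxE /= toC0 !mulr0 !addr0.
have e2 : x 0 i2 * toC ls = z * x 0 i2.
  by move: (e i2); rewrite mxE big_ord3 !mxE /= toC0 !mulr0 !add0r.
have e1 : x 0 i0 * toC p + x 0 i1 * toC m + x 0 i2 * toC r = z * x 0 i1.
  by move: (e i1); rewrite mxE big_ord3 !mxE /=.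
have [h0|h0] := eqVneq (x 0 i0) 0; last first.
  move/eqP: e0; rewrite mulrC -subr_eq0 -mulrBl mulf_eq0 (negbTE h0) orbF subr_eq0.
  move=> /eqP <-; apply: real_complex_norm_neq1.
  by rewrite gtr0_norm ?gt_eqF//; apply: lt_trans lu1.
have [h2|h2] := eqVneq (x 0 i2) 0; last first.
  move/eqP: e2; rewrite mulrC -subr_eq0 -mulrBl mulf_eq0 (negbTE h2) orbF subr_eq0.
  move=> /eqP <-; apply: real_complex_norm_neq1; case/andP: ls01 => ls0 ls1.
  by rewrite gtr0_norm ?lt_eqF.
have h1 : x 0 i1 != 0.
  apply: contra x0 => /eqP h1; apply/eqP/rowP => j.
  by rewrite mxE; case: (ord3P j) => ->.
move: e1; rewrite h0 h2 !mul0r add0r addr0 => /eqP.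
rewrite mulrC -subr_eq0 -mulrBl mulf_eq0 (negbTE h1) orbF subr_eq0.
move=> /eqP <-; apply: real_complex_norm_neq1.
rewrite ltr0_norm ?(lt_trans m1) ?ltrN10//.
by apply/eqP => h; move: m1; rewrite -(opprK m) h ltxx.
Qed.

(** The plane spanned by the first two basis vectors. *)
Definition uc_frame : 'M[R]_(2, 3) := \matrix_(i, j) ((i : nat) == j)%:R.

Lemma uc_frame_memP (x : V) : reflect (x 0 i2 = 0) (x <= uc_frame)%MS.
Proof.
apply: (iffP submxP) => [[D ->]|h].
  by rewrite !mxE big_ord2 !mxE /= !mulr0 addr0.
exists (\row_j [:: x 0 i0; x 0 i1]`_j).
apply/rowP => j; rewrite mxE big_ord2 !mxE /=.
by case: (ord3P j) => -> /=; rewrite ?mulr0 ?mulr1 ?addr0 ?add0r.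
Qed.

Lemma rank_uc_frame : \rank uc_frame = 2%N.
Proof.
apply/eqP; rewrite -[_ == _]/(row_free _); apply/row_freeP; exists uc_frame^T.
apply/matrixP => i j; rewrite mxE big_ord3 !mxE /=.
case: i => -[|[|//]] hi; case: j => -[|[|//]] hj /=;
 by rewrite ?(mulr0, mulr1, addr0, add0r).
Qed.

Lemma eigenrow_backward (v : V) l n : l != 0 -> v *m A = l *: v ->
  v *m invmx A ^+ n = (l^-1) ^+ n *: v.
Proof.
move=> l0 h.
have h1 : v *m invmx A = l^-1 *: v.
  by rewrite -[LHS](scalerK l0) scalemxAl -h mulmxK.
elim: n => [|n IH]; first by rewrite !expr0 mulmx1 scale1r.
by rewrite !exprSr mulmxA IH -scalemxAl h1 scalerA.
Qed.

Lemma geometric_row_cvg (v : V) (l : R) : 1 < `|l| ->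
  (fun n => (l^-1) ^+ n *: v) @ \oo --> (0 : V).
Proof.
move=> l1; rewrite -(scale0r v); apply: cvgZl; apply: cvg_expr.
by rewrite normfV invf_lt1// (lt_trans _ l1).
Qed.

Lemma coords_mul (x : V) : x *m P *m A = x *m model_mx lu ls p m r *m P.
Proof. by rewrite AE !mulmxA -(mulmxA x) PP mulmx1. Qed.

(** The first two coordinates are split along the eigenvectors of the multipliers
    [lu] and [m], both larger than 1 in modulus. *)
Lemma uc_backward_cvg (x : V) : x 0 i2 = 0 ->
  (fun n => x *m P *m invmx A ^+ n) @ \oo --> (0 : V).
Proof.
move=> x2.
have l1 := lu1; have mm := m1.
have lm : lu - m != 0 by rewrite gt_eqF//; lra.
(* [graph_row a 0] is the eigenvector of the multiplier [lu]. *)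
pose a := p / (lu - m).
have ea : p + a * m = lu * a by rewrite /a; field.
have eu : graph_row a 0 *m P *m A = lu *: (graph_row a 0 *m P).
  rewrite coords_mul scalemxAl; congr (_ *m P).
  apply/rowP => j; rewrite graph_row_mulE !mxE /=.
  by case: (ord3P j) => -> /=; rewrite ?mulr0 ?mul0r ?mulr1 ?addr0// ea.
have ec : center_vec R *m P *m A = m *: (center_vec R *m P).
  rewrite coords_mul scalemxAl; congr (_ *m P).
  by rewrite (center_vec_model lu ls (fun _ => p) (fun _ => m) (fun _ => r) (tproj 0)).
have xE : x = x 0 i0 *: graph_row a 0 + (x 0 i1 - x 0 i0 * a) *: center_vec R.
  apply/rowP => j; rewrite ![in RHS]mxE; case: (ord3P j) => -> /=; last 1 first.
  - by rewrite x2; ring.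
  - ring.
  - ring.
have lu0 : lu != 0 by rewrite gt_eqF//; lra.
have m0 : m != 0 by rewrite lt_eqF//; lra.
have -> : (fun n => x *m P *m invmx A ^+ n) = (fun n =>
    (lu^-1) ^+ n *: (x 0 i0 *: (graph_row a 0 *m P)) +
    (m^-1) ^+ n *: ((x 0 i1 - x 0 i0 * a) *: (center_vec R *m P))).
  apply/funext => n; rewrite {1}xE !mulmxDl -!scalemxAl.
  rewrite (eigenrow_backward _ lu0 eu) (eigenrow_backward _ m0 ec).
  by rewrite !scalerA; congr (_ *: _ + _ *: _); rewrite mulrC.
rewrite -[X in _ --> X](addr0 (0 : V)); apply: cvgD; apply: geometric_row_cvg.
  by rewrite gtr0_norm// (lt_trans _ lu1).
by rewrite ltr0_norm; lra.
Qed.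

(** The third coordinate is a left eigenfunctional of the matrix; backward iteration
    multiplies it by 1 / ls, so only rows without third coordinate can converge to 0. *)
Lemma stable_coord_backward (v : V) n :
  (v *m invmx A ^+ n *m P^T) 0 i2 = (ls^-1) ^+ n * (v *m P^T) 0 i2.
Proof.
have ls0 : ls != 0 by rewrite gt_eqF//; case/andP: ls01.
have step (w : V) : (w *m invmx A *m P^T) 0 i2 = ls^-1 * (w *m P^T) 0 i2.
  set y := w *m invmx A.
  have -> : w = y *m P^T *m P *m A.
    by rewrite -(mulmxA y) (mulmx1C PP) mulmx1 /y mulmxKV.
  rewrite coords_mul -(mulmxA _ P) PP mulmx1.
  rewrite [in RHS]mxE big_ord3 [model_mx _ _ _ _ _ i0 _]mxE [model_mx _ _ _ _ _ i1 _]mxE.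
  rewrite [model_mx _ _ _ _ _ i2 _]mxE /= !mulr0 !add0r.
  by rewrite mulrCA mulVf// mulr1.
elim: n => [|n IH]; first by rewrite !expr0 mulmx1 mul1r.
by rewrite !exprSr mulmxA step IH mulrCA mulrA.
Qed.

Lemma saddle_unstable_space : exists W : 'M[R]_3, \rank W = 2%N /\
  unstable_space A = [set v | (v <= W)%MS].
Proof.
have free := isometry_row_free PP.
exists <<uc_frame *m P>>%MS; split.
  by rewrite genmxE mxrankMfree// rank_uc_frame.
apply/seteqP; split=> v /=; rewrite genmxE.
- move=> hv; have vE : v = v *m P^T *m P by rewrite -mulmxA (mulmx1C PP) mulmx1.
  rewrite {}vE submxMfree//; apply/uc_frame_memP; apply/eqP/negPn/negP => x2.
  set x := (v *m P^T) 0 i2 in x2.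
  have cP : (fun w : V => (w *m P^T) 0 i2) (v *m invmx A ^+ n) @[n --> \oo] --> (0 : R).
    have c0 : continuous (fun w : V => (w *m P^T) 0 i2).
      move=> w; apply: (@continuous_comp _ _ _ (fun y : V => y *m P^T) (fun M : V => M 0 i2)).
        exact: continuous_mulrow.
      exact: (@coord_continuous R 1 3 0 i2).
    have -> : (0 : R) = ((0 : V) *m P^T) 0 i2 by rewrite mul0mx mxE.
    exact: (continuous_cvg _ (c0 0) hv).
  have pos : 0 < `|x| by rewrite normr_gt0.
  move/cvgrPdist_lt: cP => /(_ _ pos)[N _ /(_ N (leqnn N))].
  rewrite sub0r normrN stable_coord_backward normrM -/x; apply/negP.
  rewrite -leNgt ler_peMl// normrX normfV exprn_ege1//.
  case/andP: ls01 => l0 l1; rewrite gtr0_norm// invf_ge1//; exact: ltW.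
- move=> hv; have vE : v = v *m P^T *m P by rewrite -mulmxA (mulmx1C PP) mulmx1.
  move: hv; rewrite {1}vE submxMfree// => /uc_frame_memP x2.
  by rewrite /unstable_space /= vE; exact: uc_backward_cvg.
Qed.

End Saddle.

Section Perturbation.
Variable R : realType.

Lemma dominated_near_model (C : 'M[R]_3) (lu ls p m r : R) :
  224/100 <= lu <= 225/100 -> 554/1000 <= ls <= 556/1000 ->
  `|p| <= 8/100 -> -1002/1000 <= m <= -601/1000 -> `|r| <= 48/1000 ->
  (forall i j, `|C i j - model_mx lu ls p m r i j| <= 1/1000) -> dominated_mx C.
Proof.
move=> /andP[u1 u2] /andP[s1 s2] hp /andP[m1 m2] hr h.
move: (h i0 i0) (h i0 i1) (h i0 i2) (h i1 i0) (h i1 i1) (h i1 i2) (h i2 i0)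
  (h i2 i1) (h i2 i2).
rewrite /dominated_mx !mxE /= !subr0 => {h}.
move: (C i0 i0) (C i0 i1) (C i0 i2) (C i1 i0) (C i1 i1) (C i1 i2) (C i2 i0)
  (C i2 i1) (C i2 i2) => {C} x00 x01 x02 x10 x11 x12 x20 x21 x22.
have near0 (x : R) : `|x| <= 1/1000 -> `|x| <= 2/1000.
  by clear; lra.
have nearby (x y c d : R) : `|y| <= c -> c + 1/1000 <= d -> `|x - y| <= 1/1000 ->
    `|x| <= d.
  move=> hy hcd; rewrite -{2}(subrK y x) => hx; apply: le_trans (ler_normD _ _) _.
  by clear -hy hcd hx; lra.
move=> b00 b01 b02 b10 b11 b12 b20 b21 b22.
split.
- by move: b00; rewrite ler_norml => /andP[k1 k2]; clear -k1 u1; lra.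
- split; [|exact: near0|exact: near0|exact: near0].
  by apply: nearby hp _ b01; clear; lra.
- by split; [exact: near0|apply: nearby hr _ b21; clear; lra].
- rewrite ler_norml in b11; rewrite ler_norml in b22.
  case/andP: b11 => k1 k2; case/andP: b22 => k3 k4.
  have l1 : x11 <= -59/100 by clear -m2 k2; lra.
  have l2 : -102/100 <= x11 by clear -m1 k1; lra.
  rewrite ler0_norm; last by clear -l1; lra.
  split; apply/andP; split.
  + by clear -l1; lra.
  + by clear -l2; lra.
  + by clear -s1 k3; lra.
  + by clear -s2 k4; lra.
Qed.

Lemma entry_norm_le m n (E : 'M[R]_(m, n)) i j : `|E i j| <= `|E|.
Proof.
rewrite [leRHS]/Num.Def.normr/= mx_normrE.
exact: (le_bigmax _ (fun ij => `|E ij.1 ij.2|) (i, j)).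
Qed.

Lemma isometry_entry_le (P : 'M[R]_3) i j : P *m P^T = 1%:M -> `|P i j| <= 1.
Proof.
move=> /(congr1 (fun M : 'M[R]_3 => M i i)).
rewrite mxE [RHS]mxE eqxx mulr1n (bigD1 j)//= mxE => h.
have h0 : 0 <= \sum_(k < 3 | k != j) P i k * P^T k i.
  by apply: sumr_ge0 => k _; rewrite mxE -expr2 sqr_ge0.
rewrite -(@ler_pXn2r _ 2)// ?nnegrE// expr1n real_normK ?num_real// expr2; lra.
Qed.

(** Each entry is a sum of nine terms, and the entries of an orthogonal matrix are at
    most 1 in absolute value. *)
Lemma conj_entry_le (P E : 'M[R]_3) e i j : P *m P^T = 1%:M -> `|E| <= e ->
  `|(P *m E *m P^T) i j| <= 9 * e.
Proof.
move=> PP hE.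
have hk l : `|(P *m E) i l| <= 3 * e.
  rewrite mxE big_ord3; apply: le_trans (ler_normD _ _) _.
  apply: le_trans (lerD (ler_normD _ _) (lexx _)) _.
  have h k : `|P i k * E k l| <= 1 * e.
    apply: ler_norm_mul; first exact: isometry_entry_le.
    exact: le_trans (entry_norm_le _ _ _) hE.
  have := h i0; have := h i1; have := h i2; lra.
rewrite mxE big_ord3; apply: le_trans (ler_normD _ _) _.
apply: le_trans (lerD (ler_normD _ _) (lexx _)) _.
have h l : `|(P *m E) i l * P^T l j| <= (3 * e) * 1.
  by apply: ler_norm_mul; [exact: hk|rewrite mxE; exact: isometry_entry_le].
have := h i0; have := h i1; have := h i2; lra.
Qed.

End Perturbation.

Theorem theorem2p1 (R : realType) :
  exists (f : torus R -> torus R) (Eu Ec Fs : torus R -> 'M[R]_3),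
    [/\ smooth_diffeo f,
        ph_splitting3 f Eu Ec Fs,
        ph_splitting f Eu (sum_bundle Ec Fs) /\ volume_expanding_along f Eu,
        exists p, hyperbolic_fixed_point f p 2
      & exists2 U : set (torus R -> torus R), C1_nbhd f U &
          forall g, U g -> Ck_diffeo 1 g -> partially_volume_expanding g].
Proof.
have [P [lu [lc [ls [PP PM [bu bc bs] k0 [r0 r2]]]]]] := eigenbasis_exists R.
pose f : torus R -> torus R := da_map P.
have fS : smooth_diffeo f := da_map_smooth PM bc k0.
have f1 : Ck_diffeo 1 f := fS 1%N.
pose rho i := (P *m phase_covec R) i 0 / (P *m phase_covec R) i1 0.
pose q (p : torus R) : R := tilt (trepr p).
pose mu p := lc + q p.
pose al p := q p * rho i0.
pose ga p := q p * rho i2.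
have coords p : P *m tangent f p *m P^T = model_mx lu ls (al p) (mu p) (ga p).
  by have := da_map_coordinates PP PM k0 (trepr p); rewrite treprK.
have qB p : `|q p| <= 1/5 by exact: tilt_le.
have alB p : `|al p| <= 8/100.
  by apply: le_trans (ler_norm_mul (qB p) r0) _; clear; lra.
have gaB p : `|ga p| <= 48/1000.
  by apply: le_trans (ler_norm_mul (qB p) r2) _; clear; lra.
have muB p : -1002/1000 <= mu p <= -601/1000.
  move: (qB p) bc; rewrite ler_norml /mu => /andP[k1 k2] /andP[k3 k4].
  by clear -k1 k2 k3 k4; apply/andP; split; lra.
have CE p : tangent f p = P^T *m model_mx lu ls (al p) (mu p) (ga p) *m P.
  by rewrite -coords !mulmxA (mulmx1C PP) mul1mx -mulmxA (mulmx1C PP) mulmx1.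
have cC i j : lift_continuous (fun p => model_mx lu ls (al p) (mu p) (ga p) i j).
  have -> : (fun p => model_mx lu ls (al p) (mu p) (ga p) i j) =
      (fun p => (P *m tangent f p *m P^T) i j).
    by apply/funext => p; rewrite coords.
  apply: lift_continuous_conj => k l.
  by apply: C1_tangent_entry_continuous; case: f1.
have cmu : lift_continuous mu.
  by have := cC i1 i1; congr (lift_continuous _); apply/funext => p; rewrite mxE.
have cga : lift_continuous ga.
  by have := cC i2 i1; congr (lift_continuous _); apply/funext => p; rewrite mxE.
have dC p : dominated_mx (model_mx lu ls (al p) (mu p) (ga p)).
  apply: (dominated_near_model bu bs (alB p) (muB p) (gaB p)) => i j.
  by rewrite subrr normr0; clear; lra.
have [Eu [Ec [Fs [ph3 ph vol]]]] := model_splitting f1 PP CE cmu cga cC dC bs muB gaB.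
exists f, Eu, Ec, Fs; split=> //.
- exists (tproj 0).
  have tE : P *m tangent f (tproj 0) *m P^T =
      model_mx lu ls (- (1/5) * rho i0) (lc - 1/5) (- (1/5) * rho i2).
    have := da_map_coordinates PP PM k0 0.
    by rewrite /tilt mul0mx mxE mulr0 cos0 mulr1.
  have AE : tangent f (tproj 0) = P^T *m
      model_mx lu ls (- (1/5) * rho i0) (lc - 1/5) (- (1/5) * rho i2) *m P.
    by rewrite -tE !mulmxA (mulmx1C PP) mul1mx -mulmxA (mulmx1C PP) mulmx1.
  have Au := diffeo_tangent_unit (tproj 0) f1.
  have lu1 : 1 < lu by case/andP: bu => k _; clear -k; lra.
  have m1 : lc - 1/5 < -1 by case/andP: bc => _ k; clear -k; lra.
  have ls01 : 0 < ls < 1 by case/andP: bs => k1 k2; clear -k1 k2; apply/andP; split; lra.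
  split.
  + rewrite /f /da_map induced_tproj; last exact: da_lift_equivariant.
    have e : ((0 : 'rV_3) *m phase_covec R) 0 0 = 0 by rewrite mul0mx mxE.
    by rewrite /da_lift /wave e mul0mx mulr0 sin0 mulr0 scale0r !addr0.
  + exact: (saddle_hyperbolic PP AE).
  + exact: (saddle_unstable_space PP AE).
(* By [conj_entry_le] the coordinates in the eigenbasis then differ by at most 1/1000. *)
- exists [set g | forall p, `|tangent f p - tangent g p| <= 1/9000].
    exists (1/9000); first by lra.
    by move=> g _ h p; have [_ /ltW] := h p.
  move=> g /= gU gd; apply: (dominated_partially_volume_expanding PP gd) => p.
  apply: (dominated_near_model bu bs (alB p) (muB p) (gaB p)) => i j.
  rewrite -coords distrC.
  have -> : (P *m tangent f p *m P^T) i j - (P *m tangent g p *m P^T) i j =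
      (P *m (tangent f p - tangent g p) *m P^T) i j.
    by rewrite mulmxBr mulmxBl !mxE.
  by apply: le_trans (conj_entry_le _ _ PP (gU p)) _; lra.
Qed.
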